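(* Let $G=(V,E)$ be a finite simple graph with $|V|=n$ and tree-width $\mathrm{tw}(G)$. The single bond flip chain on $G$ has the following mixing time bounds, for the indicated edge subset weights $w_G(S)>0$, $S\subseteq E$. 1. (Random cluster model / Tutte polynomial.) For fixed $q,\mu>0$ and $w_G(S)=q^{\kappa(S)}\mu^{|S|}$, $$\tau(\varepsilon)=O\left(n^{4+4(\mathrm{tw}(G)+1)|\log_2 q|}\log(1/\varepsilon)\right).$$ Equivalently, for fixed $x,y>1$ and $w_G(S)=(x-1)^{r(E)-r(S)}(y-1)^{|S|-r(S)}$, $$\tau(\varepsilon)=O\left(n^{4+4(\mathrm{tw}(G)+1)|\log_2((x-1)(y-1))|}\log(1/\varepsilon)\right).$$ 2. (Adjacency-rank polynomial $R_2$.) For fixed $q,\mu>0$ and $w_G(S)=q^{\mathrm{rk}_2(S)}\mu^{|S|}$, $$\tau(\varepsilon)=O\left(n^{4+8(\mathrm{tw}(G)+1)|\log_2 q|}\log(1/\varepsilon)\right).$$ 3. (Multivariate Tutte polynomial.) For fixed $q>0$ and fixed $v_e>0$ for all $e\in E$, and $w_G(S)=q^{\kappa(S)}\prod_{e\in S}v_e$, $$\tau(\varepsilon)=O\left(n^{4+4(\mathrm{tw}(G)+1)|\log_2 q|}\log(1/\varepsilon)\right).$$ 4. ($U$-polynomial.) For fixed $y>1$ and fixed $x_i>0$ for all $i$, and $w_G(S)=(y-1)^{|S|-r(S)}\prod_{i=1}^{|V|}x_i^{\kappa(i,S)}$, $$\tau(\varepsilon)=O\left(n^{4+4(\mathrm{tw}(G)+1)|\log_2(y'x'^3)|}\log(1/\varepsilon)\right),$$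 where $x'=\max_i\max\{x_i,x_i^{-1}\}$ and $y'=\max\{y-1,(y-1)^{-1}\}$.
   Context: All graphs are finite and simple. For $G=(V,E)$ and $S\subseteq E$: $\kappa(S)$ is the number of connected components of $(V,S)$; $\kappa(i,S)$ is the number of components of $(V,S)$ having exactly $i$ vertices; $r(S)$ is the rank over $\mathbb{F}_2$ of the (vertex-edge) incidence matrix of $(V,S)$; $\mathrm{rk}_2(S)$ is the rank over $\mathbb{F}_2$ of the adjacency matrix of $(V,S)$. The corresponding polynomials are the sums $\sum_{S\subseteq E}w_G(S)$. Single bond flip chain on $G=(V,E)$ (with $E\neq\emptyset$) associated with positive weights $w_G$: the state space is $\Omega=2^E$. From $X_t\subseteq E$, pick $e\in E$ uniformly at random, let $S=X_t\oplus\{e\}$ ($\oplus$ is symmetric difference), and set $X_{t+1}=S$ with probability $\frac12\min\{1,w_G(S)/w_G(X_t)\}$ and $X_{t+1}=X_t$ otherwise. Its unique stationary distribution $\pi$ satisfies $\pi(S)\propto w_G(S)$. Mixing time. $\|\nu-\nu'\|_{TV}=\frac12\sum_{H\in\Omega}|\nu(H)-\nu'(H)|$, and with $P$ the transition matrix, $\tau(\varepsilon)=\max_{H\in\Omega}\min\{t: \|P^t(H,\cdot)-\pi\|_{TV}\le\varepsilon\}$. In the bounds, $0<\varepsilon\le1/2$, and the implied constants may depend on $\mathrm{tw}(G)$ and on the fixed parameters (in part 3 on $q$ and $\max_e\max\{v_e,v_e^{-1}\}$; in part 4 on $x'$ and $y'$), but not otherwise on $G$ and not on $\varepsilon$. 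*)

(* Defs.v *)
From HB Require Import structures.
From mathcomp Require Import all_boot all_order all_algebra.
From mathcomp Require Import boolp classical_sets reals ereal exp.
(* Imported last so that set0, setU, etc. are those of finite sets. *)
From mathcomp Require Import finset.

Set Implicit Arguments.
Unset Strict Implicit.
Unset Printing Implicit Defensive.

Import Order.TTheory GRing.Theory Num.Theory.
Local Open Scope ring_scope.

(* Finite simple graphs: an edge is a two-element set of vertices.  The
   spanning subgraph (V, S) is represented by its edge set S. *)
Record sgraph := SGraph {
  vertex :> finType;
  edges : {set {set vertex}};
  edges_card2 : forall e, e \in edges -> #|e| = 2 }.

Section SpanningSubgraph.
Variable V : finType.
Implicit Types S : {set {set V}}.

(* Irreflexive as soon as the members of S have two elements, since
   [set u; u] is a singleton. *)
Definition adj S : rel V := [rel u v | [set u; v] \in S].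

Definition components S : {set {set V}} :=
  equivalence_partition (connect (adj S)) [set: V].

Definition kappa S : nat := #|components S|.

Definition kappa_size (i : nat) S : nat :=
  #|[set K in components S | #|K| == i]|.

Definition incidence_mx S : 'M['F_2]_(#|V|, #|S|) :=
  \matrix_(i, j) (enum_val i \in (enum_val j : {set V}))%:R.

Definition inc_rank S : nat := \rank (incidence_mx S).

Definition adjacency_mx S : 'M['F_2]_#|V| :=
  \matrix_(i, j) (adj S (enum_val i) (enum_val j))%:R.

Definition rk2 S : nat := \rank (adjacency_mx S).

End SpanningSubgraph.

Definition is_tree (T : sgraph) : Prop :=
  [/\ (0 < #|T|)%N,
      forall s t : T, connect (adj (edges T)) s t &
      forall c : seq T, ucycle (adj (edges T)) c -> (size c <= 2)%N].

Definition tree_decomposition (G T : sgraph) (bag : T -> {set G}) : Prop :=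
  [/\ is_tree T,
      forall v : G, exists t, v \in bag t,
      forall e, e \in edges G -> exists t, e \subset bag t &
      forall (v : G) (s t : T), v \in bag s -> v \in bag t ->
        connect [rel a b | [&& adj (edges T) a b, v \in bag a & v \in bag b]]
          s t].

Definition has_tree_decomposition_of_width (G : sgraph) (k : nat) : Prop :=
  exists (T : sgraph) (bag : T -> {set G}),
    tree_decomposition bag /\ (\max_(t : T) #|bag t|).-1 = k.

Lemma tree_decomposition_exists (G : sgraph) :
  exists k, `[< has_tree_decomposition_of_width G k >].
Proof.
have no_edge (e : {set unit}) : e \in (set0 : {set {set unit}}) -> #|e| = 2.
  by rewrite inE.
exists (\max_(t : SGraph no_edge) #|[set: G]|).-1; apply/asboolP.
exists (SGraph no_edge), (fun=> [set: G]); split=> //; split.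
- split=> [|[] []|c].
  + by rewrite card_unit.
  + exact: connect0.
  + case/andP=> _ /card_uniqP <-.
    by apply: leq_trans (max_card _) _; rewrite card_unit.
- by move=> v; exists tt; rewrite inE.
- by move=> e _; exists tt; rewrite subsetT.
- by move=> v [] [] _ _; exact: connect0.
Qed.

Definition treewidth (G : sgraph) : nat := ex_minn (tree_decomposition_exists G).

Section MarkovChain.
Variables (R : realType) (Omega : finType) (P : Omega -> Omega -> R).

Fixpoint Ppow (t : nat) (H H' : Omega) : R :=
  if t is t'.+1 then \sum_K Ppow t' H K * P K H' else (H == H')%:R.

Definition stationary (pi : Omega -> R) : Prop :=
  [/\ forall H, 0 <= pi H, \sum_H pi H = 1 &
      forall H', \sum_H pi H * P H H' = pi H'].

Definition TV (nu nu' : Omega -> R) : R := 2^-1 * \sum_H `|nu H - nu' H|.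

(* The infimum of a nonempty set of naturals is its minimum; it is +oo when
   the set of times is empty. *)
Definition mixing_time (pi : Omega -> R) (eps : R) : \bar R :=
  \big[maxe/0%E]_(H : Omega)
    ereal_inf [set t%:R%:E | t in [set t | TV (Ppow t H) pi <= eps]]%classic.

End MarkovChain.

Section BondFlip.
Variables (R : realType) (G : sgraph) (w : {set {set G}} -> R).

Definition bond_state : finType := {S : {set {set G}} | S \subset edges G}.

Definition flip (X : {set {set G}}) (e : {set G}) : {set {set G}} :=
  (X :\: [set e]) :|: ([set e] :\: X).

Definition accept (X S : {set {set G}}) : R := 2^-1 * Num.min 1 (w S / w X).

Definition bond_flip (X Y : bond_state) : R :=
  \sum_(e in edges G) #|edges G|%:R^-1 *
    (accept (val X) (flip (val X) e) * (val Y == flip (val X) e)%:R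
     + (1 - accept (val X) (flip (val X) e)) * (Y == X)%:R).

End BondFlip.

(* The stationary distribution of the chain: there is one, so quantifying over
   all of them below is not vacuous. *)
Lemma gibbs_stationary (R : realType) (G : sgraph) (w : {set {set G}} -> R) :
    edges G != set0 -> (forall S : {set {set G}}, S \subset edges G -> 0 < w S) ->
  stationary (bond_flip w)
    (fun S => w (val S) / \sum_(S' : bond_state G) w (val S')).
Proof.
move=> E0 w_gt0; set Z := \sum_S' _.
have w0 (X : bond_state G) : 0 < w (val X) by apply: w_gt0; exact: (valP X).
have Z_gt0 : 0 < Z.
  rewrite /Z (bigD1 (Sub set0 (sub0set _) : bond_state G)) //=.
  rewrite ltr_pwDl ?w_gt0 ?sub0set ?sumr_ge0 // => X _; exact/ltW/w0.
split=> [X||Y].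
- by rewrite divr_ge0 // ltW.
- by rewrite -mulr_suml divff ?gt_eqF.
have flipK (X : {set {set G}}) e : flip (flip X e) e = X.
  by apply/setP=> u; rewrite !inE; case: (u == e); case: (u \in X).
under eq_bigr do rewrite mulrAC.
rewrite -mulr_suml; congr (_ / _).
under eq_bigr do rewrite mulr_sumr.
rewrite exchange_big /=.
rewrite (eq_bigr (fun=> #|edges G|%:R^-1 * w (val Y))) => [|e eE].
  rewrite sumr_const -mulrnAl -[_ *+ _]mulr_natr mulVf ?mul1r //.
  by rewrite pnatr_eq0 cards_eq0.
have Y'E : flip (val Y) e \subset edges G.
  apply/fintype.subsetP=> u; rewrite !inE.
  case/orP=> /andP[]; last by move=> _ /eqP ->.
  by move=> _; apply: (fintype.subsetP (valP Y)).
pose Y' : bond_state G := Sub (flip (val Y) e) Y'E.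
under eq_bigr do rewrite mulrCA mulrDr.
rewrite -mulr_sumr big_split /=; congr (_ * _).
rewrite [X in X + _](bigD1 Y') //= big1 ?addr0 => [|X XY']; last first.
  case: eqP => [YX|_]; last by rewrite !mulr0.
  by case/eqP: XY'; apply: val_inj; rewrite /= YX flipK.
rewrite flipK eqxx mulr1 [X in _ + X](bigD1 Y) //= big1 ?addr0 => [|X XY]; last first.
  by rewrite eq_sym (negbTE XY) !mulr0.
rewrite eqxx mulr1 mulrBr mulr1 addrCA addrC.
apply/eqP; rewrite addrC -subr_eq0 addrAC subrr; apply/eqP.
suff accC (a b : R) : 0 < a -> 0 < b ->
    a * (2^-1 * Num.min 1 (b / a)) = 2^-1 * Num.min a b.
  rewrite /accept (accC _ _ (w0 Y) (w0 Y')) (accC _ _ (w0 Y') (w0 Y)).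
  by rewrite minC addrC subrr ?add0r ?subrr.
move=> a0 b0; rewrite mulrCA minr_pMr ?ltW // mulr1 mulrCA divff ?mulr1 //.
by rewrite gt_eqF.
Qed.

Definition log2 (R : realType) (x : R) : R := ln x / ln 2.

(* tau(eps) <= C * n ^ d * log (1 / eps) for 0 < eps <= 1/2. *)
Definition mixing_bound (R : realType) (G : sgraph) (w : {set {set G}} -> R)
    (C d : R) : Prop :=
  forall (pi : bond_state G -> R) (eps : R),
    stationary (bond_flip w) pi -> 0 < eps -> eps <= 2^-1 ->
    (mixing_time (bond_flip w) pi eps
       <= (C * (#|G|%:R `^ d) * ln (eps^-1))%:E)%E.

Section Weights.
Variables (R : realType) (G : sgraph).
Implicit Types S : {set {set G}}.

Definition rc_weight (q mu : R) S : R := q ^+ kappa S * mu ^+ #|S|.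

(* Both exponents are differences a - b with b <= a. *)
Definition tutte_weight (x y : R) S : R :=
  (x - 1) ^+ (inc_rank (edges G) - inc_rank S)
  * (y - 1) ^+ (#|S| - inc_rank S).

Definition R2_weight (q mu : R) S : R := q ^+ rk2 S * mu ^+ #|S|.

Definition multi_tutte_weight (q : R) (v : {set G} -> R) S : R :=
  q ^+ kappa S * \prod_(e in S) v e.

Definition U_weight (y : R) (x : nat -> R) S : R :=
  (y - 1) ^+ (#|S| - inc_rank S)
  * \prod_(1 <= i < #|G|.+1) x i ^+ kappa_size i S.

End Weights.

(* Main.v *)
Require Import Defs.
From mathcomp Require Import all_boot all_order all_algebra.
From mathcomp Require Import reals ereal sequences exp.
From mathcomp Require Import ring lra zify.
From mathcomp Require boolp.
Import Order.TTheory GRing.Theory Num.Theory.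

(* Removing a balanced bag of a tree decomposition repeatedly yields an order of
   the edges in which each prefix and its complement share at most
   s = (tw + 1) log2 (2n) vertices, so that L ^ s = O(n ^ ((tw + 1) log2 L)).
   Turn X into Y by changing the edges in this order.  With A a prefix, X is
   first taken to the state Z equal to Y on A and to X off A, and C denotes the
   state with the roles exchanged; (X, Y) |-> (Z, C) is an involution, and
   w X * w Y <= L ^ s * w Z * w C, because component counts and F_2-ranks are
   additive over A and its complement up to an error bounded by the number of
   shared vertices.  Cauchy-Schwarz along the path gives the Poincare inequality
   with constant 4 |E|^2 L^s, and the logarithm of 1 / min pi is O(n + |E|), where
   |E| <= s n; since s ^ 3 = O(n), this accounts for the factor n ^ 4.  The chain
   is lazy and reversible, so the chi-square distance to stationarity decays at
   the rate given by the Poincare constant, without any spectral theory. *)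

Set Implicit Arguments.
Unset Strict Implicit.
Unset Printing Implicit Defensive.

(** * Edge orders of small vertex separation *)

(** The transition across an edge [e] at the hybrid state Z carries the minimum of the weights of Z
    and of its flip, so a single exchange inequality is not enough. Those at two consecutive
    prefixes bound [w X * w Y] by [w Z * w C] and by the same product for the two flipped states,
    each up to L ^ s; the one containing the smaller weight is used. Allowing both partners, C and
    its flip, costs a factor 2. With the path length |E| from Cauchy-Schwarz and the inverse 2 |E|
    of the lazy proposal probability this gives 4 |E|^2 L ^ s. Since (X, Y) |-> (Z, C) is a
    bijection, the sum over pairs factors and replaces a count of the paths through a transition. If
    comparing one state with its two halves loses a factor a per shared vertex, then L = a ^ 4, as
    X, Y, Z and C are all compared; hence the 4 in the exponents. In an adjacency matrix a shared
    vertex accounts for a row and a column, hence the 8. The base 2 of the logarithm comes from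
    halving: there are c levels with 2 ^ c at most 2n, so a loss of 2 ^ b per level is polynomial in
    n of degree b. *)

Section AvoidingWalks.
Variable T : sgraph.
Hypothesis treeT : is_tree T.
Local Notation adjT := (adj (edges T)).

Lemma adj_sym (V : finType) (S : {set {set V}}) : symmetric (adj S).
Proof. by move=> u v; rewrite /adj /= setUC. Qed.

Lemma adj_irr (G : sgraph) : irreflexive (adj (edges G)).
Proof. by move=> u; apply/negP=> /edges_card2; rewrite setUid cards1. Qed.

Definition avoid (t : T) : rel T := [rel x y | [&& adjT x y, x != t & y != t]].

Lemma avoid_sym t : connect_sym (avoid t).
Proof.
apply: sym_connect_sym => x y; rewrite /avoid /adj /= [[set y; x]]setUC.
by rewrite [(y != t) && _]andbC.
Qed.

Lemma connect_avoid_neq t x y : connect (avoid t) x y -> x != t -> y != t.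
Proof.
move=> /connectP[p + ->]; elim: p x => //= z p IH x /andP[/and3P[_ _ zt] pz] _.
exact: IH zt.
Qed.

(** The first walk avoids [s] and the second avoids [t], so neither uses the edge between them.
    Together they join [s] to [t], and the edge closes a cycle. *)
Lemma tree_bridge s t x : adjT s t ->
  connect (avoid s) t x -> connect (avoid t) s x -> False.
Proof.
move=> st ctx csx.
pose del : rel T := [rel a b | adjT a b && ~~ ((a \in [:: s; t]) && (b \in [:: s; t]))].
have sub_s : subrel (avoid s) (connect del).
  move=> a b /= /and3P[ab aS bS]; apply: connect1; apply/andP; split=> //; rewrite !inE.
  rewrite (negbTE aS) (negbTE bS) /=; apply/andP=> -[/eqP at_ /eqP bt].
  by move: ab; rewrite at_ bt adj_irr.
have sub_t : subrel (avoid t) (connect del).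
  move=> a b /= /and3P[ab aS bS]; apply: connect1; apply/andP; split=> //; rewrite !inE.
  rewrite (negbTE aS) (negbTE bS) !orbF /=; apply/andP=> -[/eqP at_ /eqP bt].
  by move: ab; rewrite at_ bt adj_irr.
have /connectP[p] : connect del s t.
  apply: connect_trans (connect_sub sub_t csx) _.
  by apply: (connect_sub sub_s); rewrite avoid_sym.
case/shortenP=> {p} p p_path p_uniq _ def_t.
have p_cycle : ucycle adjT (s :: p).
  rewrite /ucycle p_uniq andbT /= rcons_path -def_t adj_sym st andbT.
  by apply: (@sub_path _ del) p_path => u v /andP[].
(* A [ucycle] of size 2 is an edge walked back and forth, which trees allow; here it would have to
   be the deleted edge. *)
case: treeT => _ _ /(_ _ p_cycle); case: p p_path p_uniq def_t p_cycle => [|a [|//]].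
- by move=> _ _ /= ts; move: st; rewrite ts adj_irr.
- by move=> + _ ta => /andP[/andP[_]]; rewrite ta !inE !eqxx orbT.
Qed.

(** [s] is the second vertex of a simple path from [t] to [x], which never returns to [t]. *)
Lemma tree_next t x : x != t -> exists s, adjT t s /\ connect (avoid t) s x.
Proof.
case: treeT => _ conn _ xt; have /connectP[p] := conn t x.
case/shortenP=> {p} [[|s p] p_path p_uniq _ def_x].
  by rewrite def_x eqxx in xt.
move: p_path => /= /andP[ts p_path]; exists s; split=> //.
apply/connectP; exists p => //.
move: p_uniq => /andP[+ _]; elim: p s {ts def_x} p_path => //= a p IH s.
case/andP=> sa ap; rewrite !inE !negb_or => /and3P[ts ta tp].
apply/andP; split; last by apply: IH => //; rewrite inE negb_or ta.
by apply/and3P; split; rewrite // eq_sym.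
Qed.

End AvoidingWalks.

(** * Bags of a tree decomposition as balanced separators *)

Section BalancedBag.
Variables (G T : sgraph) (bag : T -> {set G}).
Hypothesis decT : tree_decomposition bag.
Local Notation adjT := (adj (edges T)).

Let treeT : is_tree T. Proof. by case: decT. Qed.

(** The nodes whose bags contain [v] are connected among themselves, and [t] is not one of them. *)
Lemma bag_avoid t v x y : v \notin bag t -> v \in bag x -> v \in bag y ->
  connect (avoid t) x y.
Proof.
move=> vt vx vy; case: decT => _ _ _ /(_ v x y vx vy).
apply: connect_sub => a b /and3P[ab va vb]; apply: connect1.
by apply/and3P; split=> //; apply: contraNneq vt => <-.
Qed.

(* If every bag left a class of more than half of U, some heavy classes at the
   two ends of a tree edge would meet; follow the heavy side from a bag whose
   heavy side is smallest. *)
Lemma balanced_bag (U : {set G}) : exists (t : T) (c : G -> T),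
  (forall e u v, e \in edges G -> u \in e -> v \in e ->
     u \notin bag t -> v \notin bag t -> c u = c v) /\
  (forall a, (#|[set v in U :\: bag t | c v == a]|.*2 <= #|U|)%N).
Proof.
have [|home homeP] := @fin_all_exists G (fun=> T) (fun v t => v \in bag t).
  by case: decT.
(* The branch at [t] holding a chosen bag of [v]. By [bag_avoid] the choice does not matter when [v]
   is outside [bag t]. *)
pose cl t v := fingraph.root (avoid t) (home v).
suff [t Ht] : exists t, forall a,
    (#|[set v in U :\: bag t | cl t v == a]|.*2 <= #|U|)%N.
  exists t, (cl t); split=> // e u v eE ue ve ut vt.
  apply/eqP; rewrite root_connect; last exact: avoid_sym.
  case: decT => _ _ /(_ e eE)[b /subsetP eb] _.
  apply: (connect_trans (bag_avoid ut (homeP u) (eb _ ue))).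
  exact: (bag_avoid vt (eb _ ve) (homeP v)).
case: (boolP [exists t, [forall a, #|[set v in U :\: bag t | cl t v == a]|.*2 <= #|U|]]).
  by move=> /existsP[t /forallP Ht]; exists t.
rewrite negb_exists => /forallP heavy.
have [|a aP] := @fin_all_exists T (fun=> T) (fun t a =>
    #|U| < #|[set v in U :\: bag t | cl t v == a]|.*2).
  by move=> t; have := heavy t; rewrite negb_forall => /existsP[a]; rewrite -ltnNge; exists a.
pose H t := [set v in U :\: bag t | cl t v == a t].
pose K t := [set x | fingraph.root (avoid t) x == a t].
(* Each of the two sets has more than half of the elements of [U]. *)
have meet s t : exists v, v \in H s :&: H t.
  apply/set0Pn; rewrite -card_gt0.
  have := aP s; have := aP t; have := cardsUI (H s) (H t).
  have : #|H s :|: H t| <= #|U|.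
    by apply/subset_leq_card/subsetP=> v; rewrite !inE => /orP[] /andP[/andP[]].
  rewrite -!/(H _); lia.
case: (treeT) => /card_gt0P[t0 _] _ _.
have [t _ t_min] := @arg_minnP T t0 xpredT (fun t => #|K t|) isT.
have [v0] := meet t t; rewrite setIid !inE => /andP[/andP[v0t _] /eqP v0a].
have neq_home v s : v \notin bag s -> home v != s.
  by apply: contraNneq => <-; exact: homeP.
have [s [ts conn_s]] := tree_next treeT (neq_home _ _ v0t).
have st : adjT s t by rewrite adj_sym.
have sK : s \in K t.
  by rewrite inE -v0a root_connect //; exact: avoid_sym.
have [v] := meet s t.
rewrite !inE => /andP[/andP[/andP[vs _] /eqP vas] /andP[/andP[vt _] /eqP vat]].
have csv : connect (avoid t) s (home v).
  by move: sK; rewrite inE -vat root_connect //; exact: avoid_sym.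
have KsE x : (x \in K s) = connect (avoid s) (home v) x.
  by rewrite inE -vas root_connect 1?(avoid_sym s) //; exact: avoid_sym.
(* Otherwise [home v] would be reached from [t] avoiding [s] and from [s] avoiding [t]. *)
have tNK : t \notin K s.
  by rewrite KsE avoid_sym; apply/negP => /(tree_bridge treeT st)/(_ csv).
suff /proper_card : K s \proper K t by rewrite ltnNge t_min.
apply/properP; split; last first.
  exists s => //; rewrite KsE; apply/negP => /connect_avoid_neq.
  by move=> /(_ (neq_home _ _ vs)); rewrite eqxx.
(* A walk that starts in [K s] and avoids [s] stays in [K s], so it avoids [t] as well. *)
apply/subsetP=> x; rewrite KsE => /connectP[p p_path ->{x}].
rewrite inE -vat root_connect; last exact: avoid_sym.
rewrite avoid_sym; apply/connectP; exists p => //.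
have: home v \in K s by rewrite KsE.
elim: p (home v) p_path => //= y p IH x /andP[xy yp] xK.
have yK : y \in K s by move: xK; rewrite !KsE => /connect_trans; apply; exact: connect1.
rewrite IH // andbT; case/and3P: xy => xy _ _; apply/and3P; split=> //.
  by apply: contraNneq tNK => <-.
by apply: contraNneq tNK => <-.
Qed.

End BalancedBag.

(** * Edge orders by recursive separation *)

Section EdgeLayout.
Variable G : sgraph.
Implicit Types (U X : {set G}) (l : seq {set G}).

Definition touched l (v : G) : bool := has (fun e : {set G} => v \in e) l.
Definition incident U : {set {set G}} := [set e in edges G | ~~ [disjoint e & U]].
Definition inner U : {set {set G}} := [set e in edges G | e \subset U].

(* Only vertices of U count in the separator, although the edges of incident U
   may leave U: this is what makes layouts compose. *)
Definition layout U s : Prop :=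
  (exists l, [/\ uniq l, l =i incident U &
     forall i, #|[set v in U | touched (take i l) v && touched (drop i l) v]| <= s])
  /\ #|inner U| <= s * #|U|.

Lemma incidentP U e v : e \in edges G -> v \in e -> v \in U -> e \in incident U.
Proof.
move=> eE ve vU; rewrite inE eE /=; apply/negP => /pred0P/(_ v).
by rewrite /= ve vU.
Qed.

Lemma touched_take i l v : touched (take i l) v -> touched l v.
Proof. by case/hasP=> e /mem_take el ve; apply/hasP; exists e. Qed.

Lemma touched_drop i l v : touched (drop i l) v -> touched l v.
Proof. by case/hasP=> e /mem_drop el ve; apply/hasP; exists e. Qed.

Lemma edge_neq0 e : e \in edges G -> exists v, v \in e.
Proof. by move=> /edges_card2 e2; apply/card_gt0P; rewrite e2. Qed.

Lemma layout0 s : layout set0 s.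
Proof.
split; last first.
  rewrite cards0 muln0 leqn0 cards_eq0; apply/eqP/setP => e; rewrite !inE.
  by apply/andP => -[/edge_neq0[v ve] /subsetP/(_ v ve)]; rewrite inE.
exists [::]; split=> // [e|i]; last first.
  by rewrite (_ : [set _ | _] = set0) ?cards0 //; apply/setP => v; rewrite !inE.
by rewrite !inE disjoint_sym disjoints_subset sub0set andbF.
Qed.

Lemma layout_leq U s s' : s <= s' -> layout U s -> layout U s'.
Proof.
move=> ss' [[l [ul lE lb]] ib]; split; last by apply: leq_trans ib _; rewrite leq_mul2r ss' orbT.
by exists l; split=> // i; apply: leq_trans (lb i) ss'.
Qed.

(** Concatenate the two orders. A cut falls within one of the lists, and a vertex of the other set,
    touched only by the other list, has all its edges on one side. *)
Lemma layoutU U1 U2 s : [disjoint U1 & U2] -> [disjoint incident U1 & incident U2] ->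
  layout U1 s -> layout U2 s -> layout (U1 :|: U2) s.
Proof.
move=> dU dI [[l1 [ul1 l1E l1b]] i1b] [[l2 [ul2 l2E l2b]] i2b].
have incU : incident (U1 :|: U2) = incident U1 :|: incident U2.
  apply/setP=> e; rewrite !inE -andb_orr; congr (_ && _).
  by rewrite !disjoints_subset setCU subsetI negb_and.
have incE U e : e \in incident U -> e \in edges G by rewrite inE => /andP[].
have no1 v : v \in U2 -> ~~ touched l1 v.
  move=> vU; apply/negP => /hasP[e]; rewrite l1E => e1 ve.
  have e2 := incidentP (incE _ _ e1) ve vU.
  by move/pred0P: dI => /(_ e); rewrite /= e1 e2.
have no2 v : v \in U1 -> ~~ touched l2 v.
  move=> vU; apply/negP => /hasP[e]; rewrite l2E => e1 ve.
  have e2 := incidentP (incE _ _ e1) ve vU.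
  by move/pred0P: dI => /(_ e); rewrite /= e1 e2.
split; last first.
  have -> : #|U1 :|: U2| = #|U1| + #|U2|.
    by apply/eqP; have := leq_card_setU U1 U2; rewrite dU => /leqifP.
  rewrite mulnDr; apply: leq_trans (leq_add i1b i2b).
  apply: leq_trans (leq_card_setU _ _); apply/subset_leq_card/subsetP => e.
  rewrite !inE => /andP[eE eU]; rewrite eE /=.
  have [e1|e1] := boolP (e \in incident U1).
    apply/orP; left; apply/subsetP=> v ve; have := subsetP eU _ ve.
    rewrite inE => /orP[//|v2].
    by move/pred0P: dI => /(_ e); rewrite /= e1 (incidentP eE ve v2).
  apply/orP; right; apply/subsetP=> v ve; have := subsetP eU _ ve.
  rewrite inE => /orP[v1|//].
  by rewrite (incidentP eE ve v1) in e1.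
exists (l1 ++ l2); split=> [|e|i].
- rewrite cat_uniq ul1 ul2 andbT; apply/hasPn => e; rewrite l1E l2E => e2.
  by apply/negP=> e1; move/pred0P: dI => /(_ e); rewrite /= e1 e2.
- by rewrite mem_cat l1E l2E incU [RHS]inE.
rewrite take_cat drop_cat; case: ltnP => _.
  apply: leq_trans (l1b i); apply/subset_leq_card/subsetP => v.
  rewrite !inE => /andP[+ /andP[t1]].
  have v1 := touched_take t1; move=> /orP[vU|/no1]; last by rewrite v1.
  by rewrite /touched has_cat -!/(touched _ _) (negbTE (no2 _ vU)) orbF vU t1.
apply: leq_trans (l2b (i - size l1)); apply/subset_leq_card/subsetP => v.
rewrite !inE => /andP[+ /andP[+ t2]].
have v2 := touched_drop t2; move=> /orP[/no2|vU]; first by rewrite v2.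
by rewrite /touched has_cat -!/(touched _ _) (negbTE (no1 _ vU)) vU t2 /= => ->.
Qed.

(** The edges that meet [U] only in [X] are put in front. They touch no vertex of [U :\: X], so
    every cut gains vertices of [X] only. An edge inside [U] but not inside [U :\: X] is a pair of a
    vertex of [X] and one of [U], which accounts for the edge count. *)
Lemma layoutD U X s : layout (U :\: X) s -> layout U (s + #|X|).
Proof.
move=> [[l [ul lE lb]] ib].
have incE W e : e \in incident W -> e \in edges G by rewrite inE => /andP[].
have incUX e : e \in incident (U :\: X) -> e \in incident U.
  rewrite !inE => /andP[-> /=]; apply: contra; rewrite !disjoints_subset.
  by move=> /subset_trans; apply; rewrite setCS subsetDl.
split; last first.
  have : inner U \subset inner (U :\: X) :|:
      [set [set p.1; p.2] | p in setX X U].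
    apply/subsetP=> e; rewrite inE => /andP[eE eU]; rewrite !inE eE /=.
    rewrite subsetD eU /=; have [//|/negP dX] := boolP [disjoint e & X].
    have /cards2P[x [y [_ def_e]]] : #|e| == 2 by rewrite edges_card2.
    apply/imsetP; move: dX; rewrite def_e; have [xX _|xX] := boolP (x \in X).
      exists (x, y) => //; rewrite inE xX /=; apply: (subsetP eU).
      by rewrite def_e !inE eqxx orbT.
    have [yX _|yX []] := boolP (y \in X).
      exists (y, x); rewrite 1?setUC // inE yX /=; apply: (subsetP eU).
      by rewrite def_e !inE eqxx.
    rewrite disjoints_subset; apply/subsetP=> z.
    by rewrite !inE => /orP[] /eqP ->.
  move/subset_leq_card/leq_trans; apply.
  apply: leq_trans (leq_card_setU _ _) _; rewrite mulnDl; apply: leq_add.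
    by apply: leq_trans ib _; rewrite leq_mul2l subset_leq_card ?orbT ?subsetDl.
  by apply: leq_trans (leq_imset_card _ _) _; rewrite cardsX.
pose l0 := enum (incident U :\: incident (U :\: X)).
have no0 v : v \in U :\: X -> ~~ touched l0 v.
  move=> vU; apply/negP => /hasP[e]; rewrite mem_enum inE => /andP[eN eI] ve.
  by rewrite (incidentP (incE _ _ eI) ve vU) in eN.
exists (l0 ++ l); split=> [|e|i].
- rewrite cat_uniq ul enum_uniq andbT /=; apply/hasPn => e; rewrite lE => e2.
  by rewrite mem_enum inE e2.
- rewrite mem_cat mem_enum lE inE; case: (boolP (e \in incident (U :\: X))) => [/incUX ->|] //=.
  by rewrite orbF.
rewrite take_cat drop_cat; set B := [set v in U | _].
apply: leq_trans (_ : #|X| + #|B :\: X| <= _).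
  by rewrite -(cardsID X B) leq_add2r subset_leq_card ?subsetIr.
rewrite addnC leq_add2r /B; case: ltnP => _.
  rewrite (_ : _ :\: _ = set0) ?cards0 //; apply/setP => v; rewrite !inE.
  apply/negP=> /andP[vX /andP[vU /andP[/touched_take t0 _]]].
  by have := no0 v; rewrite t0 inE vU vX => /(_ isT).
apply: leq_trans (lb (i - size l0)); apply/subset_leq_card/subsetP => v.
rewrite !inE => /andP[vX /andP[vU /andP[+ ->]]]; rewrite vX vU andbT /=.
have vUX : v \in U :\: X by rewrite inE vX vU.
by rewrite /touched has_cat -/(touched l0 v) (negbTE (no0 _ vUX)) andbT.
Qed.

Section Tree.
Variables (T : sgraph) (bag : T -> {set G}) (b : nat).
Hypothesis decT : tree_decomposition bag.
Hypothesis bagb : forall t, #|bag t| <= b.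

(** Each level removes a bag, at cost [b], and leaves pieces of at most half the size; no edge meets
    two pieces, so [layoutU] joins them at no cost. The doubling under the logarithm pays for the
    last bag, removed from a single vertex. *)
Lemma layout_tree U : layout U (b * trunc_log 2 #|U|.*2).
Proof.
have [n] := ubnP #|U|; elim: n U => // n IH U ltUn.
have [->|U0] := eqVneq U set0; first exact: layout0.
have Ugt0 : 0 < #|U| by rewrite card_gt0.
have [t [c [cE cU]]] := balanced_bag decT U.
set s := b * trunc_log 2 #|U|.
suff /layoutD : layout (U :\: bag t) s.
  apply: layout_leq; rewrite trunc_log2_double // mulnS addnC leq_add2r.
  exact: bagb.
(* Unions of pieces, so that the pieces are joined one label at a time. *)
pose W (r : seq T) := [set v in U :\: bag t | c v \in r].
suff WP r : uniq r -> layout (W r) s.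
  have := WP _ (enum_uniq T); congr (layout _ _).
  by apply/setP=> v; rewrite inE mem_enum inE andbT.
elim: r => [_|a r IHr /= /andP[ar ur]].
  by rewrite (_ : W [::] = set0); [exact: layout0 | apply/setP=> v; rewrite !inE andbF].
have -> : W (a :: r) = [set v in U :\: bag t | c v == a] :|: W r.
  by apply/setP=> v; rewrite !inE -andb_orr.
apply: layoutU (IHr ur).
- apply/pred0P=> v; rewrite /= !inE; apply/negP.
  by case/andP=> /andP[_ /eqP ->]; rewrite (negbTE ar) andbF.
- apply/pred0P=> e; rewrite /= !in_set; apply/negP.
  case/andP=> /andP[eE /pred0Pn[u /= /andP[ue uW]]] /andP[_ /pred0Pn[v /= /andP[ve vW]]].
  move: uW vW; rewrite in_set => /andP[/setDP[_ ut] /eqP cu].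
  rewrite in_set => /andP[/setDP[_ vt] cv].
  by move: cv; rewrite -(cE e u v) // cu (negbTE ar).
have cUa := cU a; have ltW : #|[set v in U :\: bag t | c v == a]| < n by lia.
by apply: layout_leq (IH _ ltW); rewrite leq_mul2l leq_trunc_log ?cUa ?orbT.
Qed.

End Tree.

(** For [U = setT] every edge is both incident and inner. Bags have at most [k.+1] vertices because
    the width is the largest bag size minus one. *)
Lemma treewidth_layout (k : nat) : treewidth G = k ->
  exists l, [/\ uniq l, l =i edges G,
    forall i, #|[set v | touched (take i l) v && touched (drop i l) v]|
                <= k.+1 * trunc_log 2 #|G|.*2 &
    #|edges G| <= k.+1 * trunc_log 2 #|G|.*2 * #|G|].
Proof.
rewrite /treewidth; case: ex_minnP => j /boolp.asboolP[T [bag [decT bagj]]] _ <-.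
have bagP t : #|bag t| <= j.+1.
  by rewrite -bagj; apply: leq_trans (leq_bigmax t) (leqSpred _).
have [[l [ul lE lb]] ib] := layout_tree decT bagP setT.
rewrite cardsT in lb ib; exists l; split=> // [e|i|].
- rewrite lE inE andbC; case: (boolP (e \in edges G)) => [eE|]; rewrite ?andbF //.
  rewrite andbT disjoints_subset setCT subset0 -cards_eq0.
  by rewrite (edges_card2 eE).
- apply: leq_trans (lb i); apply/subset_leq_card/subsetP=> v.
  by rewrite !inE.
- apply: leq_trans ib; apply/subset_leq_card/subsetP=> e eE.
  by rewrite inE eE subsetT.
Qed.

End EdgeLayout.

Local Open Scope ring_scope.

(** * Mixing of lazy reversible chains *)

Section ReversibleLazyChain.
Variables (R : realType) (Omega : finType) (P : Omega -> Omega -> R).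
Variable pi : Omega -> R.
Implicit Types f g : Omega -> R.

Definition norm2 f : R := \sum_x pi x * f x ^+ 2.
Definition dirichlet f : R := 2^-1 * \sum_x \sum_y pi x * P x y * (f x - f y) ^+ 2.
Definition markov_op f x : R := \sum_y P x y * f y.

(** The difference of the two sides is the variance of [f] under [p]. *)
Lemma jensen_sqr (I : finType) (p f : I -> R) :
    (forall i, 0 <= p i) -> \sum_i p i = 1 ->
  (\sum_i p i * f i) ^+ 2 <= \sum_i p i * f i ^+ 2.
Proof.
move=> p_ge0 p1; set m := \sum_i p i * f i.
rewrite -subr_ge0; have -> : \sum_i p i * f i ^+ 2 - m ^+ 2 =
    \sum_i p i * (f i - m) ^+ 2.
  rewrite [RHS](eq_bigr (fun i =>
    p i * f i ^+ 2 - 2 * m * (p i * f i) + m ^+ 2 * p i)) => [|i _]; last by ring.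
  by rewrite big_split sumrB /= -!mulr_sumr p1 -/m; ring.
by apply: sumr_ge0 => i _; rewrite mulr_ge0 ?sqr_ge0.
Qed.

Hypothesis pi_gt0 : forall x, 0 < pi x.
Hypothesis pi_sum1 : \sum_x pi x = 1.
Hypothesis P_sum1 : forall x, \sum_y P x y = 1.
Hypothesis P_ge0 : forall x y, 0 <= P x y.
Hypothesis P_rev : forall x y, pi x * P x y = pi y * P y x.

Lemma norm2_ge0 f : 0 <= norm2 f.
Proof. by apply: sumr_ge0 => x _; rewrite mulr_ge0 ?sqr_ge0 // ltW. Qed.

Lemma norm2_eq0 f : norm2 f <= 0 -> forall x, f x = 0.
Proof.
move=> f0 x; have /eqP : norm2 f = 0 by apply/le_anti; rewrite f0 norm2_ge0.
rewrite psumr_eq0 => [/allP/(_ x (mem_index_enum _))/=|y _]; last first.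
  by rewrite mulr_ge0 ?sqr_ge0 // ltW.
by rewrite mulf_eq0 gt_eqF //= sqrf_eq0 => /eqP.
Qed.

Lemma sum_markov_op f : \sum_x pi x * markov_op f x = \sum_x pi x * f x.
Proof.
rewrite /markov_op; under eq_bigr do rewrite mulr_sumr.
rewrite exchange_big /=; apply: eq_bigr => y _.
under eq_bigr do rewrite mulrA P_rev -mulrA mulrCA.
by rewrite -mulr_suml P_sum1 mul1r.
Qed.

Lemma dirichletE f : dirichlet f = norm2 f - \sum_x pi x * (f x * markov_op f x).
Proof.
have sqr_y : \sum_x \sum_y pi x * P x y * f y ^+ 2 = norm2 f.
  rewrite -[RHS](sum_markov_op (fun x => f x ^+ 2)); apply: eq_bigr => x _.
  by rewrite mulr_sumr; apply: eq_bigr => y _; rewrite mulrA.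
have sqr_x : \sum_x \sum_y pi x * P x y * f x ^+ 2 = norm2 f.
  by apply: eq_bigr => x _; rewrite -mulr_suml -mulr_sumr P_sum1 mulr1.
have cross : \sum_x \sum_y pi x * P x y * (f x * f y) =
    \sum_x pi x * (f x * markov_op f x).
  apply: eq_bigr => x _; rewrite /markov_op !mulr_sumr.
  by apply: eq_bigr => y _; ring.
rewrite -cross /dirichlet (eq_bigr (fun x => \sum_y pi x * P x y * f x ^+ 2 +
    \sum_y pi x * P x y * f y ^+ 2 - 2 * \sum_y pi x * P x y * (f x * f y))).
  by rewrite sumrB big_split /= sqr_x sqr_y -mulr_sumr; lra.
move=> x _; rewrite mulr_sumr -big_split -sumrB /=.
by apply: eq_bigr => y _; ring.
Qed.

Hypothesis P_lazy : forall x, 2^-1 <= P x x.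

(* For Q = 2P - 1, which is stochastic since P is lazy,
   <f, Pf> - <Pf, Pf> = (|f|^2 - |Qf|^2) / 4, and Q is a contraction. *)
Lemma norm2_markov_op f : norm2 (markov_op f) <= norm2 f - dirichlet f.
Proof.
pose Q x y := 2 * P x y - (x == y)%:R.
have Q_ge0 x y : 0 <= Q x y.
  rewrite /Q; case: eqP => [<-|_]; last by rewrite subr0 mulr_ge0.
  by have := P_lazy x; rewrite mulr1n; lra.
have Q_sum1 x : \sum_y Q x y = 1.
  rewrite sumrB -mulr_sumr P_sum1 (bigD1 x) //= eqxx big1 => [|y].
    by rewrite addr0 mulr1n mulr1; lra.
  by rewrite eq_sym => /negbTE ->.
have QE g x : \sum_y Q x y * g y = 2 * markov_op g x - g x.
  rewrite /Q; under eq_bigr do rewrite mulrBl -mulrA.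
  rewrite sumrB -mulr_sumr -/(markov_op g x) (bigD1 x) //= eqxx mul1r big1 ?addr0 // => y.
  by rewrite eq_sym => /negbTE ->; rewrite mul0r.
have Q_contr : norm2 (fun x => 2 * markov_op f x - f x) <= norm2 f.
  apply: (@le_trans _ _ (\sum_x pi x * (2 * markov_op (fun y => f y ^+ 2) x - f x ^+ 2))).
    apply: ler_sum => x _; rewrite ler_pM2l // -!QE.
    exact: jensen_sqr.
  under eq_bigr do rewrite mulrBr mulrCA.
  by rewrite sumrB -mulr_sumr sum_markov_op /norm2; lra.
have -> : norm2 f - dirichlet f = \sum_x pi x * (f x * markov_op f x).
  by rewrite dirichletE; lra.
rewrite -subr_ge0 -(pmulr_rge0 _ (_ : 0 < 4)) //.
apply: le_trans (_ : 0 <= norm2 f - norm2 (fun x => 2 * markov_op f x - f x)) _.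
  by rewrite subr_ge0.
rewrite /norm2 -!sumrB mulr_sumr; apply: ler_sum => x _.
by rewrite le_eqVlt; apply/orP; left; apply/eqP; ring.
Qed.

Variable rho : R.
Hypothesis rho_ge1 : 1 <= rho.
Hypothesis poincare : forall f, \sum_x pi x * f x = 0 -> norm2 f <= rho * dirichlet f.

Let rho_gt0 : 0 < rho. Proof. exact: lt_le_trans rho_ge1. Qed.

(** By reversibility the density of [nu] minus one is fixed by [P]. Its norm does not decrease, so
    its Dirichlet form is at most 0, and the Poincare inequality makes it vanish. *)
Lemma stationary_uniq (nu : Omega -> R) : stationary P nu -> nu = pi.
Proof.
case=> _ nu1 nuP; pose f x := nu x / pi x - 1.
have pif x : pi x * f x = nu x - pi x.
  by rewrite mulrBr mulr1 mulrCA divff ?mulr1 ?gt_eqF.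
have Pf x : markov_op f x = f x.
  apply: (mulfI (lt0r_neq0 (pi_gt0 x))).
  rewrite /markov_op mulr_sumr.
  under eq_bigr do rewrite mulrA P_rev mulrAC pif mulrBl.
  rewrite sumrB nuP pif; congr (_ - _).
  by under eq_bigr do rewrite P_rev; rewrite -mulr_sumr P_sum1 mulr1.
have mean0 : \sum_x pi x * f x = 0.
  by under eq_bigr do rewrite pif; rewrite sumrB nu1 pi_sum1 subrr.
have f0 : forall x, f x = 0.
  apply: norm2_eq0.
  have := norm2_markov_op f; have -> : norm2 (markov_op f) = norm2 f.
    by apply: eq_bigr => x _; rewrite Pf.
  rewrite -subr_ge0 addrAC subrr sub0r oppr_ge0 => D_le0.
  by apply: le_trans (poincare mean0) _; rewrite pmulr_rle0.
by apply/boolp.funext => x; apply/eqP; rewrite -subr_eq0 -pif f0 mulr0.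
Qed.

Section Start.
Variable H : Omega.

Definition density t x := Ppow P t H x / pi x - 1.

Lemma pi_density t x : pi x * density t x = Ppow P t H x - pi x.
Proof. by rewrite mulrBr mulr1 mulrCA divff ?mulr1 ?gt_eqF. Qed.

Lemma Ppow_sum1 t : \sum_x Ppow P t H x = 1.
Proof.
elim: t => /= [|t IH].
  rewrite (bigD1 H) //= eqxx big1 ?addr0 // => x.
  by rewrite eq_sym => /negbTE ->.
rewrite exchange_big /= -[RHS]IH; apply: eq_bigr => x _.
by rewrite -mulr_sumr P_sum1 mulr1.
Qed.

Lemma density_mean0 t : \sum_x pi x * density t x = 0.
Proof.
by under eq_bigr do rewrite pi_density; rewrite sumrB Ppow_sum1 pi_sum1 subrr.
Qed.

(** Densities evolve by the adjoint of [P], which is [P] itself by reversibility. *)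
Lemma densityS t x : density t.+1 x = markov_op (density t) x.
Proof.
apply: (mulfI (lt0r_neq0 (pi_gt0 x))).
rewrite pi_density /markov_op mulr_sumr.
under [RHS]eq_bigr do rewrite mulrA P_rev mulrAC pi_density mulrBl.
rewrite sumrB; congr (_ - _).
by under eq_bigr do rewrite P_rev; rewrite -mulr_sumr P_sum1 mulr1.
Qed.

(** Each step contracts by [1 - rho^-1], at most [expR (- rho^-1)], and the initial value is
    [(pi H)^-1 - 1]. *)
Lemma norm2_density t : norm2 (density t) <= (pi H)^-1 * expR (- (t%:R / rho)).
Proof.
have step s : norm2 (density s.+1) <= (1 - rho^-1) * norm2 (density s).
  have -> : norm2 (density s.+1) = norm2 (markov_op (density s)).
    by apply: eq_bigr => x _; rewrite densityS.
  apply: le_trans (norm2_markov_op _) _.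
  rewrite mulrBl mul1r lerD2l lerN2 mulrC ler_pdivrMr // mulrC.
  exact/poincare/density_mean0.
elim: t => [|t IH].
  rewrite mul0r oppr0 expR0 mulr1 /norm2.
  under eq_bigr do rewrite expr2 mulrA pi_density mulrBl.
  rewrite sumrB density_mean0 subr0 /= (bigD1 H) //= eqxx mul1r.
  rewrite big1 => [|x]; last by rewrite eq_sym => /negbTE ->; rewrite !mul0r.
  by rewrite addr0 /density /= eqxx mul1r gerBl.
apply: le_trans (step t) _.
apply: le_trans (_ : expR (- rho^-1) * norm2 (density t) <= _).
  by rewrite ler_wpM2r ?norm2_ge0 // -[1 - _]/(1 + - _) expR_ge1Dx.
rewrite -natr1 mulrDl mul1r opprD expRD [X in _ <= _ * X]mulrC [leRHS]mulrCA.
by rewrite ler_pM2l ?expR_gt0.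
Qed.

Lemma TV_density t : TV (Ppow P t H) pi ^+ 2 <= 4^-1 * norm2 (density t).
Proof.
have -> : TV (Ppow P t H) pi = 2^-1 * \sum_x pi x * `|density t x|.
  congr (_ * _); apply: eq_bigr => x _.
  by rewrite -pi_density normrM gtr0_norm.
rewrite exprMn (_ : 2^-1 ^+ 2 = 4^-1) ?ler_pM2l ?invr_gt0 //; last by field.
apply: le_trans (jensen_sqr _ _ _) _ => // [x|]; first exact/ltW.
by apply: ler_sum => x _; rewrite real_normK ?num_real.
Qed.

End Start.

(** At the first integer beyond [rho * (B + 2 * ln eps^-1)] the squared distance has dropped from at
    most [expR B] to at most [eps ^+ 2]. The added 1 pays for the rounding. *)
Lemma mixing_time_le (B eps T : R) :
    (forall x, (pi x)^-1 <= expR B) -> 0 < eps -> eps <= 2^-1 -> 0 <= B ->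
    rho * (B + 2 * ln eps^-1) + 1 <= T ->
  (mixing_time P pi eps <= T%:E)%E.
Proof.
move=> piB eps0 eps2 B0 leT; rewrite /mixing_time.
have ln0 : 0 <= ln eps^-1.
  by apply: ln_ge0; rewrite invf_ge1 //; lra.
set T0 := rho * _ in leT.
have T0_ge0 : 0 <= T0 by rewrite mulr_ge0 ?(ltW rho_gt0) ?addr_ge0 ?mulr_ge0.
apply: (big_ind (fun x => (x <= T%:E)%E)) => [|x y xT yT|H _].
- by rewrite lee_fin; lra.
- by rewrite ge_max xT.
pose t := (Num.truncn T0).+1.
have t_gt : T0 < t%:R by rewrite /t truncnS_gt.
have t_le : t%:R <= T.
  apply: le_trans leT; rewrite /t -natr1 lerD2r.
  by rewrite truncn_le.
apply: (@le_trans _ _ t%:R%:E); last by rewrite lee_fin.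
apply: ereal_inf_lbound; exists t => //=.
have TV_ge0 : 0 <= TV (Ppow P t H) pi by rewrite mulr_ge0 ?sumr_ge0.
rewrite -(@ler_pXn2r _ 2) ?nnegrE ?(ltW eps0) //.
apply: le_trans (TV_density H t) _.
apply: le_trans (_ : norm2 (density H t) <= _).
  by have := norm2_ge0 (density H t); lra.
apply: le_trans (norm2_density H t) _.
apply: le_trans (_ : expR B * expR (- (B + 2 * ln eps^-1)) <= _).
  apply: ler_pM; rewrite ?invr_ge0 ?expR_ge0 ?(ltW (pi_gt0 _)) //.
  by rewrite ler_expR lerN2 ler_pdivlMr // mulrC ltW.
rewrite -expRD opprD addrA subrr add0r lnV ?posrE // mulrN opprK.
by rewrite mulr_natl mulr2n expRD lnK ?posrE // expr2.
Qed.

End ReversibleLazyChain.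

(** * Exchange inequalities *)

Section Within.
Variable R : realFieldType.
Implicit Types (L a b : R).

Definition within L a b : bool := (a <= L * b) && (b <= L * a).

Lemma within_mul L1 L2 a1 a2 b1 b2 : 0 <= L1 -> 0 <= L2 ->
    0 <= a1 -> 0 <= b1 -> 0 <= a2 -> 0 <= b2 ->
  within L1 a1 b1 -> within L2 a2 b2 -> within (L1 * L2) (a1 * a2) (b1 * b2).
Proof.
move=> L1_ge0 L2_ge0 a1_ge0 b1_ge0 a2_ge0 b2_ge0 /andP[ab1 ba1] /andP[ab2 ba2].
by rewrite /within (mulrACA L1 L2 b1) (mulrACA L1 L2 a1) !ler_pM.
Qed.

Lemma within_mul1 L1 L2 b1 b2 : 0 <= L1 -> 0 <= L2 -> 0 <= b1 -> 0 <= b2 ->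
  within L1 1 b1 -> within L2 1 b2 -> within (L1 * L2) 1 (b1 * b2).
Proof.
move=> L1_ge0 L2_ge0 b1_ge0 b2_ge0 h1 h2; rewrite -[X in within _ X _](mulr1 1).
exact: within_mul.
Qed.

Lemma within_prod (I : finType) (A : pred I) L (F : I -> R) N : 1 <= L ->
    (forall i, A i -> 0 < F i /\ within L 1 (F i)) -> (#|A| <= N)%N ->
  within (L ^+ N) 1 (\prod_(i | A i) F i).
Proof.
move=> L1 AF AN; have L0 : 0 < L by apply: lt_le_trans L1.
have F0 : 0 < \prod_(i | A i) F i by apply: prodr_gt0 => i /AF[].
have LN : L ^+ #|A| <= L ^+ N by rewrite ler_weXn2l.
rewrite /within mulr1; apply/andP; split.
  apply: le_trans (_ : L ^+ #|A| * \prod_(i | A i) F i <= _).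
    apply: le_trans (_ : \prod_(i | A i) 1 <= _); first by rewrite big1.
    rewrite -prodr_const -big_split /=.
    by apply: ler_prod => i /AF[_ /andP[-> _]]; rewrite ler01.
  by rewrite ler_pM2r.
apply: le_trans LN; rewrite -prodr_const; apply: ler_prod => i /AF[Fi /andP[_]].
by rewrite mulr1 (ltW Fi) => ->.
Qed.

Lemma within_exp L z (a N : nat) : 1 <= L -> 0 < z -> within L 1 z -> (a <= N)%N ->
  within (L ^+ N) 1 (z ^+ a).
Proof.
move=> L1 z0 Lz aN; rewrite -[a]card_ord -prodr_const.
by apply: within_prod => //; rewrite card_ord.
Qed.

Lemma within_exp2 L z (a b N : nat) : 1 <= L -> 0 < z -> within L 1 z ->
  (a <= b <= a + N)%N -> within (L ^+ N) (z ^+ a) (z ^+ b).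
Proof.
move=> L1 z0 Lz /andP[ab bN]; rewrite -(subnKC ab) exprD.
have L0 : 0 <= L by apply: le_trans L1.
rewrite -{1}[z ^+ a]mulr1 -[L ^+ N]mul1r.
apply: within_mul; rewrite ?exprn_ge0 ?(ltW z0) //; first by rewrite /within !mul1r lexx.
by apply: within_exp; rewrite // leq_subLR.
Qed.

End Within.

(** * Weights under exchange of the edges of [A] between two states *)

Section Exchange.
Variables (R : realFieldType) (G : sgraph).
Implicit Types (A S X Y : {set {set G}}) (w : {set {set G}} -> R) (L : R).
Local Notation E := (edges G).

Definition swap A X Y : {set {set G}} := (Y :&: A) :|: (X :\: A).

Definition boundary A : {set G} := cover A :&: cover (E :\: A).

(** The loss is one factor [L] per shared vertex, so the constants of two weights multiply. *)
Definition exchange w L : Prop := forall A X Y,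
  A \subset E -> X \subset E -> Y \subset E ->
  w X * w Y <= L ^+ #|boundary A| * (w (swap A X Y) * w (swap A Y X)).

Lemma swapI A X Y : swap A X Y :&: A = Y :&: A.
Proof. by apply/setP=> e; rewrite !inE; case: (e \in A); rewrite ?andbF ?andbT ?orbF. Qed.

Lemma swapD A X Y : swap A X Y :\: A = X :\: A.
Proof. by apply/setP=> e; rewrite !inE; case: (e \in A); rewrite ?andbF ?andbT ?orbF. Qed.

Lemma swap_sub A X Y : X \subset E -> Y \subset E -> swap A X Y \subset E.
Proof.
move=> XE YE; rewrite subUset (subset_trans (subsetIl _ _) YE).
exact: subset_trans (subsetDl _ _) XE.
Qed.

Lemma exchangeM w1 w2 L1 L2 : 0 <= L1 -> 0 <= L2 ->
    (forall S, S \subset E -> 0 <= w1 S) -> (forall S, S \subset E -> 0 <= w2 S) ->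
  exchange w1 L1 -> exchange w2 L2 -> exchange (fun S => w1 S * w2 S) (L1 * L2).
Proof.
move=> L1_ge0 L2_ge0 w1_ge0 w2_ge0 ex1 ex2 A X Y AE XE YE.
rewrite exprMn mulrACA (mulrACA (w1 (swap _ _ _))) (mulrACA (L1 ^+ _)).
by rewrite ler_pM ?mulr_ge0 ?w1_ge0 ?w2_ge0 ?ex1 ?ex2.
Qed.

Lemma exchange_le w L L' : 0 <= L <= L' -> (forall S, S \subset E -> 0 <= w S) ->
  exchange w L -> exchange w L'.
Proof.
move=> /andP[L0 LL'] w0 ex A X Y AE XE YE; apply: le_trans (ex A X Y AE XE YE) _.
rewrite ler_wpM2r ?mulr_ge0 ?w0 ?swap_sub // lerXn2r ?nnegrE //.
exact: le_trans LL'.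
Qed.

Lemma exchange_cst c : 0 <= c -> exchange (fun=> c) 1.
Proof. by move=> c0 A X Y _ _ _; rewrite expr1n mul1r. Qed.

(** Swapping only redistributes the edges among the two states, so nothing is lost. *)
Lemma exchange_prod (v : {set G} -> R) : exchange (fun S => \prod_(e in S) v e) 1.
Proof.
move=> A X Y _ _ _; rewrite expr1n mul1r.
have split_prod S : \prod_(e in S) v e =
    \prod_(e in S :&: A) v e * \prod_(e in S :\: A) v e by exact: big_setID.
rewrite (split_prod X) (split_prod Y) (split_prod (swap A X Y)) (split_prod (swap A Y X)).
by rewrite !swapI !swapD le_eqVlt; apply/orP; left; apply/eqP; ring.
Qed.

Lemma exchange_exp (mu : R) : exchange (fun S => mu ^+ #|S|) 1.
Proof.
move=> A X Y AE XE YE; have := exchange_prod (fun=> mu) AE XE YE.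
by rewrite !prodr_const.
Qed.

(* g1 * g2 takes the same total value on X, Y and on the swapped pair, so only
   the four factors L ^ #|boundary A| are lost. *)
Lemma exchange_within w L : 1 <= L -> (forall S, S \subset E -> 0 <= w S) ->
    (forall A, A \subset E -> exists g1 g2 : {set {set G}} -> R,
       forall S, S \subset E ->
         [/\ 0 <= g1 (S :&: A), 0 <= g2 (S :\: A) &
         within (L ^+ #|boundary A|) (g1 (S :&: A) * g2 (S :\: A)) (w S)]) ->
  exchange w (L ^+ 4).
Proof.
move=> L1 w0 gP A X Y AE XE YE; have [g1 [g2 {}gP]] := gP A AE.
have ZE := swap_sub A XE YE; have CE := swap_sub A YE XE.
have [gX1 gX2 /andP[_ hX]] := gP X XE; have [gY1 gY2 /andP[_ hY]] := gP Y YE.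
have [_ _ /andP[hZ _]] := gP _ ZE; have [_ _ /andP[hC _]] := gP _ CE.
rewrite !swapI !swapD in hZ hC.
have -> : (L ^+ 4) ^+ #|boundary A| = (L ^+ #|boundary A|) ^+ 4.
  by rewrite -!exprM mulnC.
set l := L ^+ _ in hX hY hZ hC *.
apply: le_trans (ler_pM (w0 _ XE) (w0 _ YE) hX hY) _.
have l2_ge0 : 0 <= l ^+ 2 by rewrite exprn_ge0 // exprn_ge0 // (le_trans _ L1).
have := ler_wpM2l l2_ge0 (ler_pM (mulr_ge0 gY1 gX2) (mulr_ge0 gX1 gY2) hZ hC).
by congr (_ <= _); ring.
Qed.

End Exchange.

Local Arguments adj : simpl never.

(** * Connected components and products over them *)

Section Components.
Variable V : finType.
Implicit Types (S : {set {set V}}) (K : {set V}).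

Definition comp S (x : V) : {set V} := [set y | connect (adj S) x y].

Lemma comp_refl S x : x \in comp S x.
Proof. by rewrite inE connect0. Qed.

Lemma connect_adj_sym S : connect_sym (adj S).
Proof. exact/sym_connect_sym/adj_sym. Qed.

Lemma comp_eq S x y : y \in comp S x -> comp S y = comp S x.
Proof.
rewrite inE => xy; apply/setP=> z; rewrite !inE.
exact/esym/(same_connect (@connect_adj_sym S)).
Qed.

Lemma componentsE S : components S = [set comp S x | x in V].
Proof.
apply/setP=> K; apply/imsetP/imsetP => -[x _ ->].
  by exists x => //; apply/setP=> y; rewrite !inE.
by exists x; rewrite ?inE //; apply/setP=> y; rewrite !inE.
Qed.

Lemma componentP S K : reflect (exists2 x, x \in K & K = comp S x) (K \in components S).
Proof.
rewrite componentsE; apply: (iffP imsetP) => [[x _ ->]|[x _ ->]].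
  by exists x => //; exact: comp_refl.
by exists x.
Qed.

Lemma comp_local S S' x :
    (forall u v, u \in comp S x -> adj S u v = adj S' u v) ->
  comp S x = comp S' x.
Proof.
move=> SS'; have step u v : u \in comp S x -> adj S u v -> v \in comp S x.
  by rewrite !inE => xu uv; apply: connect_trans xu (connect1 uv).
apply/eqP; rewrite eqEsubset; apply/andP; split; apply/subsetP => y.
  rewrite inE => /connectP[p p_path ->{y}].
  rewrite inE; apply/connectP; exists p => //.
  elim: p {1 3 4}x (comp_refl S x) p_path => //= z p IH u ux /andP[uz zp].
  by rewrite -SS' // uz IH //; apply: step uz.
rewrite inE => /connectP[p p_path ->{y}].
elim: p {1 3 4}x (comp_refl S x) p_path => //= z p IH u ux /andP[uz zp].
by apply: IH => //; apply: (step u); rewrite // SS'.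
Qed.

Lemma card_components_meeting S (D : {set V}) :
  (#|[set K in components S | ~~ [disjoint K & D]]| <= #|D|)%N.
Proof.
apply: leq_trans (leq_imset_card (comp S) D); apply/subset_leq_card/subsetP => K.
rewrite inE => /andP[/componentP[x _ ->] /pred0Pn[y /= /andP[yx yD]]].
by apply/imsetP; exists y => //; rewrite (comp_eq yx).
Qed.

Lemma card_components S : (#|components S| <= #|V|)%N.
Proof. by rewrite componentsE; exact: leq_imset_card. Qed.

End Components.

Section ComponentWeights.
Variables (R : realFieldType) (G : sgraph).
Implicit Types (A S : {set {set G}}) (K : {set G}).
Local Notation E := (edges G).

Lemma cover_edge A e v : e \in A -> v \in e -> v \in cover A.
Proof. by move=> eA ve; apply/bigcupP; exists e. Qed.

(** No edge of [A] has an end in [K], so [S] and [S'] agree at every vertex of [K]. *)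
Lemma components_outside A S S' K : S :\: A = S' :\: A -> [disjoint K & cover A] ->
  K \in components S -> K \in components S'.
Proof.
move=> SS' KA /componentP[x xK def_K]; apply/componentP; exists x => //.
rewrite def_K; apply: comp_local => u v; rewrite -def_K => uK.
have uvA : [set u; v] \notin A.
  apply/negP=> /cover_edge/(_ (set21 u v)) uA.
  by move/pred0P: KA => /(_ u); rewrite /= uK uA.
by have /setP/(_ [set u; v]) := SS'; rewrite !in_setD uvA.
Qed.

(** At a vertex of [cover A] off the boundary all edges of the graph lie in [A]. A walk within [K]
    from such a vertex therefore stays in [cover A], where [S] and [S'] agree. *)
Lemma components_inside A S S' K : S \subset E -> S' \subset E ->
    S :&: A = S' :&: A -> [disjoint K & boundary A] -> ~~ [disjoint K & cover A] ->
  K \in components S -> K \in components S'.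
Proof.
move=> SE S'E SS' Kbd /pred0Pn[x /= /andP[xK xA]] KS.
have def_K : K = comp S x.
  by case/componentP: KS xK => y _ -> /comp_eq ->.
apply/componentP; exists x => //; rewrite {1}def_K.
have in_A u e : u \in cover A -> u \notin boundary A -> e \in E -> u \in e -> e \in A.
  move=> uA ubd eE ue; apply: contraNT ubd => eA; rewrite inE uA /=.
  by apply: cover_edge ue; rewrite inE eA.
have Nbd u : u \in K -> u \notin boundary A.
  by move=> uK; apply/negP => ub; move/pred0P: Kbd => /(_ u); rewrite /= uK ub.
have KA u : u \in K -> u \in cover A.
  rewrite def_K inE => /connectP[p p_path ->{u}].
  elim: p (x) xA p_path xK => //= z p IH u uA /andP[uz zp] uK.
  have uzA : [set u; z] \in A.
    by apply: (in_A u) => //; [exact: Nbd | exact: (subsetP SE) | exact: set21].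
  apply: IH => //; first by apply: cover_edge uzA _; exact: set22.
  move: uK; rewrite def_K !inE => /connect_trans; apply; exact: connect1.
apply: comp_local => u v; rewrite -def_K => uK.
have [uvE|uvE] := boolP ([set u; v] \in E); last first.
  by rewrite /adj /= !(contraNF (subsetP _ _) uvE).
have uvA : [set u; v] \in A.
  by apply: (in_A u) => //; [exact: KA | exact: Nbd | exact: set21].
by have /setP/(_ [set u; v]) := SS'; rewrite !in_setI uvA !andbT.
Qed.

Variables (xi : {set G} -> R) (L : R).
Hypothesis L1 : 1 <= L.
Hypothesis xi_bound : forall K, K != set0 -> 0 < xi K /\ within L 1 (xi K).

(** A constant [xi] gives [q ^+ kappa S]; a function of [#|K|] gives the component factor of the
    $U$-polynomial. *)
Definition component_weight S : R := \prod_(K in components S) xi K.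

Lemma component_neq0 S K : K \in components S -> K != set0.
Proof. by case/componentP=> x xK _; apply/set0Pn; exists x. Qed.

Lemma component_weight_gt0 S : 0 < component_weight S.
Proof. by apply: prodr_gt0 => K /component_neq0/xi_bound[]. Qed.

Lemma within_component_weight S : within (L ^+ #|G|) 1 (component_weight S).
Proof.
apply: within_prod => // [K /component_neq0/xi_bound //|].
exact: card_components.
Qed.

(* Each vertex of the boundary lies in one component, and every other component
   is one of S :&: A or of S :\: A. *)
Lemma exchange_component_weight : exchange component_weight (L ^+ 4).
Proof.
apply: exchange_within => // [S _|A AE]; first exact/ltW/component_weight_gt0.
pose p1 K := [disjoint K & boundary A] && ~~ [disjoint K & cover A].
pose p2 K := [disjoint K & cover A].
exists (fun B => \prod_(K in components B | p1 K) xi K).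
exists (fun B => \prod_(K in components B | p2 K) xi K) => S SE.
have xi_ge0 B p : 0 <= \prod_(K in components B | p K) xi K.
  by apply: prodr_ge0 => K /andP[/component_neq0/xi_bound[/ltW]].
split=> //.
have IA : S :&: A \subset E by apply: subset_trans SE; exact: subsetIl.
have -> : \prod_(K in components (S :&: A) | p1 K) xi K =
    \prod_(K in components S | p1 K) xi K.
  apply: eq_bigl => K; apply/andb_id2r => /andP[K1 K2].
  by apply/idP/idP; apply: (@components_inside A); rewrite // -setIA setIid.
have -> : \prod_(K in components (S :\: A) | p2 K) xi K =
    \prod_(K in components S | p2 K) xi K.
  apply: eq_bigl => K; apply/andb_id2r => K1.
  by apply/idP/idP; apply: (@components_outside A); rewrite // setDDl setUid.
have bd_cover K : ~~ [disjoint K & boundary A] -> ~~ p2 K.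
  move=> /pred0Pn[u /= /andP[uK]]; rewrite inE => /andP[uA _].
  by apply/pred0Pn; exists u; rewrite /= uK.
have -> : component_weight S = \prod_(K in components S | p1 K) xi K *
    \prod_(K in components S | p2 K) xi K *
    \prod_(K in components S | ~~ [disjoint K & boundary A]) xi K.
  rewrite /component_weight (bigID (fun K => [disjoint K & boundary A])) /=.
  congr (_ * _); rewrite (bigID p2) /= mulrC; congr (_ * _).
    by apply: eq_bigl => K; rewrite -andbA.
  apply: eq_bigl => K; rewrite -andbA; congr (_ && _).
  by rewrite andb_idl // => K2; apply: contraLR K2 => /bd_cover.
rewrite -[L ^+ _]mul1r -[X in within _ X _]mulr1.
apply: within_mul; rewrite ?mulr_ge0 ?xi_ge0 ?exprn_ge0 ?(le_trans _ L1) //.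
  by rewrite /within mul1r lexx.
apply: within_prod => // [K /andP[/component_neq0/xi_bound //]|].
apply: leq_trans (card_components_meeting S _).
by apply: subset_leq_card; apply/subsetP => K; rewrite !inE.
Qed.

End ComponentWeights.

(** * Ranks after clearing rows and columns *)

Section Masks.
Variable F : fieldType.

Definition mask_mx n (p : pred 'I_n) : 'M[F]_n := diag_mx (\row_i (p i)%:R).

Lemma mask_mulE m n (p : pred 'I_m) (M : 'M[F]_(m, n)) i j :
  (mask_mx p *m M) i j = (p i)%:R * M i j.
Proof. by rewrite mul_diag_mx !mxE. Qed.

Lemma mul_maskE m n (p : pred 'I_n) (M : 'M[F]_(m, n)) i j :
  (M *m mask_mx p) i j = M i j * (p j)%:R.
Proof. by rewrite mul_mx_diag !mxE. Qed.

Lemma mask_mxC n (p : pred 'I_n) : mask_mx p + mask_mx (predC p) = 1%:M.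
Proof.
apply/matrixP=> i j; rewrite !mxE /= -mulrnDl; congr (_ *+ _).
by case: (p i); rewrite ?addr0 ?add0r.
Qed.

Lemma rank_mask_mx n (p : pred 'I_n) : (\rank (mask_mx p) <= #|p|)%N.
Proof.
have -> : mask_mx p = \sum_(i | p i) delta_mx i i.
  rewrite /mask_mx diag_mx_sum_delta [RHS]big_mkcond /=; apply: eq_bigr => i _.
  by rewrite mxE; case: (p i); rewrite ?scale1r ?scale0r.
rewrite -sum1_card; apply: (big_ind2 (fun (M : 'M[F]_n) k => \rank M <= k)%N).
- by rewrite mxrank0.
- move=> M1 k1 M2 k2 Mk1 Mk2; apply: leq_trans (mxrank_add _ _) _.
  exact: leq_add.
- by move=> i _; rewrite mxrank_delta.
Qed.

Lemma rank_mask_mul m n (p : pred 'I_m) (M : 'M[F]_(m, n)) :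
  (\rank M <= \rank (mask_mx (predC p) *m M) + #|p|)%N.
Proof.
rewrite -{1}[M]mul1mx -(mask_mxC p) mulmxDl addnC.
apply: leq_trans (mxrank_add _ _) _; rewrite leq_add2r.
exact: leq_trans (mxrankM_maxl _ _) (rank_mask_mx p).
Qed.

Lemma rank_mul_mask m n (p : pred 'I_n) (M : 'M[F]_(m, n)) :
  (\rank M <= \rank (M *m mask_mx (predC p)) + #|p|)%N.
Proof.
rewrite -{1}[M]mulmx1 -(mask_mxC p) mulmxDr addnC.
apply: leq_trans (mxrank_add _ _) _; rewrite leq_add2r.
exact: leq_trans (mxrankM_maxr _ _) (rank_mask_mx p).
Qed.

(** [P] extracts [M1] from the sum, so the row space of the sum contains both row spaces. [Q] fixes
    the row space of [M1] and kills that of [M2], so the two meet trivially. *)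
Lemma rank_add_split m n (P : 'M[F]_m) (Q : 'M[F]_n) (M1 M2 : 'M[F]_(m, n)) :
    P *m M1 = M1 -> P *m M2 = 0 -> M1 *m Q = M1 -> M2 *m Q = 0 ->
  \rank (M1 + M2)%R = (\rank M1 + \rank M2)%N.
Proof.
move=> PM1 PM2 M1Q M2Q.
have PN : P *m (M1 + M2) = M1 by rewrite mulmxDr PM1 PM2 addr0.
have sub2 : (M2 <= (M1 + M2)%R)%MS.
  by apply/submxP; exists (1%:M - P); rewrite mulmxBl mul1mx PN addrC addKr.
have sub1 : (M1 <= (M1 + M2)%R)%MS by apply/submxP; exists P; rewrite PN.
have eqN : ((M1 + M2)%R :=: M1 + M2)%MS.
  apply/eqmxP; rewrite addmx_sub_adds //=.
  by rewrite addsmx_sub sub1.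
rewrite eqN mxrank_disjoint_sum //.
have /submxP[D1 def1] := capmxSl M1 M2; have /submxP[D2 def2] := capmxSr M1 M2.
by rewrite def1 -M1Q mulmxA -def1 def2 -mulmxA M2Q mulmx0.
Qed.

End Masks.

Section SpanningRanks.
Variable V : finType.
Implicit Types S : {set {set V}}.

(** The columns range over all vertex sets, so that matrices of different [S] have one size and can
    be added. *)
Definition full_incidence_mx S : 'M['F_2]_(#|V|, #|{: {set V}}|) :=
  \matrix_(i, j) ((enum_val j \in S) && (enum_val i \in enum_val j))%:R.

(** Each matrix is the other times a 0/1 matrix that inserts or selects columns, so each rank bounds
    the other. *)
Lemma inc_rankE S : inc_rank S = \rank (full_incidence_mx S).
Proof.
pose D : 'M['F_2]_(#|S|, #|{: {set V}}|) :=
  \matrix_(k, j) (enum_val k == enum_val j :> {set V})%:R.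
have def_full : full_incidence_mx S = incidence_mx S *m D.
  apply/matrixP=> i j; rewrite !mxE.
  under eq_bigr do rewrite !mxE -natrM mulnb.
  have [jS|jS] := boolP (enum_val j \in S); last first.
    rewrite big1 // => k _; case: eqP => [kj|_]; last by rewrite andbF.
    by rewrite -kj enum_valP in jS.
  rewrite (bigD1 (enum_rank_in jS (enum_val j))) //= enum_rankK_in // eqxx andbT.
  rewrite big1 ?addr0 // => k kj; case: eqP => [kj'|_]; last by rewrite andbF.
  by case/eqP: kj; apply: enum_val_inj; rewrite kj' enum_rankK_in.
have def_inc : incidence_mx S = full_incidence_mx S *m D^T.
  apply/matrixP=> i k; rewrite !mxE.
  under eq_bigr do rewrite !mxE -natrM mulnb.
  rewrite (bigD1 (enum_rank (enum_val k))) //= enum_rankK eqxx enum_valP andbT.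
  rewrite big1 ?addr0 // => j jk; case: eqP => [jk'|_]; last by rewrite andbF.
  by rewrite jk' enum_valK eqxx in jk.
apply/eqP; rewrite eqn_leq /inc_rank {1}def_inc mxrankM_maxl /=.
by rewrite def_full mxrankM_maxl.
Qed.

Lemma inc_rank_leq_card S : (inc_rank S <= #|S|)%N.
Proof. exact: rank_leq_col. Qed.

Lemma inc_rank_leq_vertices S : (inc_rank S <= #|V|)%N.
Proof. exact: rank_leq_row. Qed.

Lemma rk2_leq_vertices S : (rk2 S <= #|V|)%N.
Proof. exact: rank_leq_row. Qed.

Lemma inc_rankS S S' : S \subset S' -> (inc_rank S <= inc_rank S')%N.
Proof.
move=> SS'; rewrite !inc_rankE.
suff -> : full_incidence_mx S =
    full_incidence_mx S' *m mask_mx _ (fun j => enum_val j \in S).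
  exact: mxrankM_maxl.
apply/matrixP=> i j; rewrite mul_maskE !mxE -natrM mulnb; congr (nat_of_bool _)%:R.
by have [/(subsetP SS') -> | _] := boolP (enum_val j \in S); rewrite ?andbT ?andbF.
Qed.

End SpanningRanks.

Section RankWeights.
Variables (R : realFieldType) (G : sgraph).
Implicit Types (A S : {set {set G}}).
Local Notation E := (edges G).

Definition row_in (D : {set G}) : pred 'I_#|G| := fun i => enum_val i \in D.

Lemma card_row_in D : #|row_in D| = #|D|.
Proof.
rewrite -(card_imset _ (@enum_val_inj G predT)).
apply: eq_card => v; apply/imsetP/idP => [[i iD ->] //|vD].
by exists (enum_rank v); rewrite ?enum_rankK // unfold_in /row_in enum_rankK.
Qed.

Lemma notin_boundary A S (u : G) (e : {set G}) : S \subset E ->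
  e \in S :\: A -> u \in e -> u \in cover A -> u \in boundary A.
Proof.
move=> SE /setDP[eS eA] ue uA; rewrite inE uA /=.
by apply: cover_edge ue; rewrite inE eA (subsetP SE).
Qed.

Local Notation D A := (@mask_mx 'F_2 _ (predC (row_in (boundary A)))).

(** Once the boundary rows are cleared, edges of [A] have entries only in rows of [cover A] and the
    other edges of [S] only outside them. Masking rows by [cover A] and columns by [A] separates the
    two parts. *)
Lemma inc_rank_split A S : S \subset E ->
  \rank (D A *m full_incidence_mx S) =
  (\rank (D A *m full_incidence_mx (S :&: A)) +
   \rank (D A *m full_incidence_mx (S :\: A)))%N.
Proof.
move=> SE; transitivity (\rank (D A *m full_incidence_mx (S :&: A) +
                                D A *m full_incidence_mx (S :\: A))%R); last first.
  apply: (rank_add_split (P := mask_mx _ (row_in (cover A)))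
    (Q := mask_mx _ (fun j => enum_val j \in A))).
  - apply/matrixP=> i j; rewrite !mask_mulE !mxE /= /row_in !in_setI.
    case: (boolP (enum_val j \in A)) => [eA|_]; rewrite ?andbF ?andFb ?mulr0 //.
    case: (boolP (enum_val i \in enum_val j)) => [ie|_]; rewrite ?andbF ?andFb ?mulr0 //.
    by rewrite ?andbT (cover_edge eA ie) mul1r.
  - apply/matrixP=> i j; rewrite !mask_mulE !mxE /= /row_in.
    case: (boolP ((enum_val j \in S :\: A) && (enum_val i \in enum_val j))) =>
      [/andP[eS ie]|_]; rewrite ?mulr0 //.
    case: (boolP (enum_val i \in cover A)) => [iA|_]; rewrite ?mul0r //.
    by rewrite (notin_boundary SE eS ie iA) /= mul0r mulr0.
  - apply/matrixP=> i j; rewrite mul_maskE mask_mulE !mxE !in_setI.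
    by case: (_ \in A); rewrite ?mulr1 // andbF /= !mulr0.
  - apply/matrixP=> i j; rewrite mul_maskE mask_mulE !mxE in_setD.
    by case: (_ \in A); rewrite /= ?mulr0 ?mul0r ?mulr0.
congr (\rank _); rewrite -mulmxDr; congr (_ *m _).
apply/matrixP=> i j; rewrite !mxE !inE.
by case: (_ \in A); rewrite ?andbF ?andbT ?addr0 ?add0r.
Qed.

(** Columns are indexed by vertices too, so the boundary is cleared on both sides and [cover A]
    serves as row and as column mask. *)
Lemma rk2_split A S : S \subset E ->
  \rank (D A *m adjacency_mx S *m D A) =
  (\rank (D A *m adjacency_mx (S :&: A) *m D A) +
   \rank (D A *m adjacency_mx (S :\: A) *m D A))%N.
Proof.
move=> SE; transitivity (\rank (D A *m adjacency_mx (S :&: A) *m D A +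
                                D A *m adjacency_mx (S :\: A) *m D A)%R); last first.
  apply: (rank_add_split (P := mask_mx _ (row_in (cover A)))
    (Q := mask_mx _ (row_in (cover A)))).
  - apply/matrixP=> i j; rewrite mask_mulE !mul_maskE !mask_mulE !mxE /= /row_in /adj /= !in_setI.
    case: (boolP ([set enum_val i; enum_val j] \in A)) => [eA|_];
      rewrite ?andbF ?andFb ?mulr0 ?mul0r ?mulr0 //.
    by rewrite ?andbT (cover_edge eA (set21 _ _)) mul1r.
  - apply/matrixP=> i j; rewrite mask_mulE !mul_maskE !mask_mulE !mxE /= /row_in /adj /=.
    case: (boolP ([set enum_val i; enum_val j] \in S :\: A)) => [eS|_];
      rewrite ?mulr0 ?mul0r ?mulr0 //.
    case: (boolP (enum_val i \in cover A)) => [iA|_]; rewrite ?mul0r //.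
    by rewrite (notin_boundary SE eS (set21 _ _) iA) /= !mul0r mulr0.
  - apply/matrixP=> i j; rewrite !mul_maskE !mask_mulE !mxE /= /row_in /adj /= !in_setI.
    case: (boolP ([set enum_val i; enum_val j] \in A)) => [eA|_];
      rewrite ?andbF ?andFb ?mulr0 ?mul0r //.
    by rewrite ?andbT (cover_edge eA (set22 _ _)) mulr1.
  - apply/matrixP=> i j; rewrite !mul_maskE !mask_mulE !mxE /= /row_in /adj /=.
    case: (boolP ([set enum_val i; enum_val j] \in S :\: A)) => [eS|_];
      rewrite ?mulr0 ?mul0r //.
    case: (boolP (enum_val j \in cover A)) => [iA|_]; rewrite ?mulr0 //.
    by rewrite (notin_boundary SE eS (set22 _ _) iA) /= mulr0 mul0r.
congr (\rank _); rewrite -mulmxDl -mulmxDr; congr (_ *m _ *m _).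
apply/matrixP=> i j; rewrite !mxE /adj /= !inE.
by case: (_ \in A); rewrite ?andbF ?andbT ?addr0 ?add0r.
Qed.

Lemma exchange_inc_rank (z L : R) : 1 <= L -> 0 < z -> within L 1 z ->
  exchange (fun S : {set {set G}} => z ^+ inc_rank S) (L ^+ 4).
Proof.
move=> L1 z0 Lz; have zge0 n : 0 <= z ^+ n by rewrite exprn_ge0 // ltW.
apply: exchange_within => // A AE.
pose g B := z ^+ \rank (D A *m full_incidence_mx B).
exists g, g => S SE; split; rewrite /g ?zge0 // -exprD -inc_rank_split //.
apply: within_exp2 => //; rewrite inc_rankE mxrankM_maxr /=.
by rewrite -(card_row_in (boundary A)) rank_mask_mul.
Qed.

(** Clearing a row and a column per boundary vertex loses up to two units of rank, so a state is
    compared with factor [L ^+ 2], whose fourth power is [L ^+ 8]. *)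
Lemma exchange_rk2 (z L : R) : 1 <= L -> 0 < z -> within L 1 z ->
  exchange (fun S : {set {set G}} => z ^+ rk2 S) (L ^+ 8).
Proof.
move=> L1 z0 Lz; have zge0 n : 0 <= z ^+ n by rewrite exprn_ge0 // ltW.
rewrite (exprM L 2 4); apply: exchange_within => [|//|A AE].
  by rewrite exprn_ege1.
pose g B := z ^+ \rank (D A *m adjacency_mx B *m D A).
exists g, g => S SE; split; rewrite /g ?zge0 // -exprD -rk2_split // -exprM.
apply: within_exp2 => //; apply/andP; split.
  by apply: leq_trans (mxrankM_maxl _ _) (mxrankM_maxr _ _).
rewrite -(card_row_in (boundary A)) mul2n -addnn addnA.
apply: leq_trans (rank_mask_mul (row_in (boundary A)) _) _.
by rewrite leq_add2r rank_mul_mask.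
Qed.

End RankWeights.

(** * The Poincare inequality for the bond flip chain *)

Section BondFlipChain.
Variables (R : realType) (G : sgraph) (w : {set {set G}} -> R).
Local Notation E := (edges G).
Hypothesis E_neq0 : E != set0.
Hypothesis w_gt0 : forall S : {set {set G}}, S \subset E -> 0 < w S.
Implicit Types (X Y Z : bond_state G) (e : {set G}) (A S : {set {set G}}).

Let m : R := #|E|%:R.
Let W : R := \sum_(S : bond_state G) w (val S).

Definition gibbs X : R := w (val X) / W.

Lemma w_state X : 0 < w (val X).
Proof. by apply: w_gt0; exact: (valP X). Qed.

Lemma partition_function_gt0 : 0 < W.
Proof.
rewrite /W (bigD1 (Sub set0 (sub0set _) : bond_state G)) //=.
by rewrite ltr_pwDl ?w_gt0 ?sub0set ?sumr_ge0 // => X _; exact/ltW/w_state.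
Qed.

Let W_gt0 := partition_function_gt0.

Lemma card_edges_gt0 : 0 < m.
Proof. by rewrite ltr0n card_gt0. Qed.

Let m_gt0 := card_edges_gt0.

Lemma gibbs_gt0 X : 0 < gibbs X.
Proof. by rewrite divr_gt0 ?w_state. Qed.

Lemma gibbs_sum1 : \sum_X gibbs X = 1.
Proof. by case: (gibbs_stationary E_neq0 w_gt0). Qed.

Lemma flipK (S : {set {set G}}) e : flip (flip S e) e = S.
Proof. by apply/setP=> u; rewrite !inE; case: (u == e); case: (u \in S). Qed.

Lemma in_flip (S : {set {set G}}) e u : (u \in flip S e) = (u == e) (+) (u \in S).
Proof. by rewrite !inE; case: (u == e); case: (u \in S). Qed.

Lemma flip_neq (S : {set {set G}}) e : flip S e != S.
Proof.
by apply/eqP=> /setP/(_ e); rewrite in_flip eqxx; case: (e \in S).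
Qed.

(** The default [X] of [insubd] is taken only when [e] is not an edge. *)
Definition flip_state e X : bond_state G := insubd X (flip (val X) e).

Lemma val_flip_state e X : e \in E -> val (flip_state e X) = flip (val X) e.
Proof.
move=> eE; rewrite val_insubd ifT //; apply/subsetP=> u.
rewrite in_flip; case: eqP => [->|_] //= uX.
exact: (subsetP (valP X)).
Qed.

Lemma flip_stateK e : e \in E -> involutive (flip_state e).
Proof. by move=> eE X; apply: val_inj; rewrite !val_flip_state // flipK. Qed.

Lemma accept_ge0 S S' : S \subset E -> S' \subset E -> 0 <= accept w S S'.
Proof.
move=> SE S'E; rewrite mulr_ge0 // le_min ler01 /=.
by rewrite divr_ge0 // ltW ?w_gt0.
Qed.

Lemma accept_le S S' : accept w S S' <= 2^-1.
Proof. by rewrite ler_piMr // ge_min lexx. Qed.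

Lemma w_accept S S' : S \subset E -> w S * accept w S S' = 2^-1 * Num.min (w S) (w S').
Proof.
move=> /w_gt0 wS; rewrite /accept mulrCA minr_pMr ?ltW // mulr1.
by rewrite mulrCA divff ?mulr1 ?gt_eqF.
Qed.

Lemma bond_flip_ge0 X Y : 0 <= bond_flip w X Y.
Proof.
apply: sumr_ge0 => e eE; rewrite -val_flip_state //; set a := accept _ _ _.
have a_ge0 : 0 <= a by exact: accept_ge0 (valP X) (valP (flip_state e X)).
have a_le1 : 0 <= 1 - a by have := accept_le (val X) (val (flip_state e X)); rewrite /a; lra.
apply: mulr_ge0; first by rewrite invr_ge0 ler0n.
by apply: addr_ge0; apply: mulr_ge0; rewrite ?ler0n.
Qed.

Lemma sum_edges_cst : \sum_(e in E) m^-1 = 1.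
Proof. by rewrite sumr_const -mulr_natl divff // gt_eqF. Qed.

Lemma bond_flip_sum1 X : \sum_Y bond_flip w X Y = 1.
Proof.
rewrite exchange_big /= -[RHS]sum_edges_cst; apply: eq_bigr => e eE.
rewrite -mulr_sumr big_split /= -!mulr_sumr.
rewrite (bigD1 (flip_state e X)) //= val_flip_state // eqxx.
rewrite big1 => [|Y]; last first.
  by rewrite -(inj_eq val_inj) val_flip_state // => /negbTE ->.
rewrite (bigD1 X) //= eqxx big1 => [|Y /negbTE -> //].
by rewrite !addr0 !mulr1 addrCA subrr addr0 mulr1.
Qed.

Lemma bond_flip_lazy X : 2^-1 <= bond_flip w X X.
Proof.
apply: le_trans (_ : \sum_(e in E) m^-1 * 2^-1 <= _).
  by rewrite -mulr_suml sum_edges_cst mul1r.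
apply: ler_sum => e eE.
rewrite ler_pM2l ?invr_gt0 // eq_sym (negbTE (flip_neq _ _)) eqxx mulr0 add0r mulr1.
by have := accept_le (val X) (flip (val X) e); lra.
Qed.

(** Off the diagonal only accepted flips count, and the Metropolis ratio becomes a minimum symmetric
    in the two states, whence reversibility. *)
Lemma w_bond_flip X Y : X != Y ->
  w (val X) * bond_flip w X Y =
  \sum_(e in E) (2 * m)^-1 * Num.min (w (val X)) (w (val (flip_state e X)))
                * (Y == flip_state e X)%:R.
Proof.
move=> XY; rewrite mulr_sumr; apply: eq_bigr => e eE.
rewrite [Y == X]eq_sym (negbTE XY) mulr0 addr0 -val_flip_state // (inj_eq val_inj).
have := w_accept (val (flip_state e X)) (valP X).
rewrite invfM; set a := accept _ _ _; set b := (_ == _)%:R => wa.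
transitivity (m^-1 * (w (val X) * a) * b); first by ring.
by rewrite wa; ring.
Qed.

Lemma bond_flip_reversible X Y : gibbs X * bond_flip w X Y = gibbs Y * bond_flip w Y X.
Proof.
have [->//|XY] := eqVneq X Y.
rewrite /gibbs mulrAC [RHS]mulrAC; congr (_ / _).
have YX : Y != X by rewrite eq_sym.
rewrite !w_bond_flip //; apply: eq_bigr => e eE.
have -> : (X == flip_state e Y) = (Y == flip_state e X).
  by apply/eqP/eqP => ->; rewrite flip_stateK.
by case: eqP => [->|]; rewrite ?mulr0 // flip_stateK // minC.
Qed.

Lemma dirichlet_bond_flip f : dirichlet (bond_flip w) gibbs f =
  (4 * m * W)^-1 * \sum_X \sum_(e in E)
    Num.min (w (val X)) (w (val (flip_state e X))) * (f X - f (flip_state e X)) ^+ 2.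
Proof.
rewrite /dirichlet mulr_sumr [RHS]mulr_sumr; apply: eq_bigr => X _.
transitivity (2^-1 * \sum_Y \sum_(e in E) W^-1 * ((2 * m)^-1 *
    Num.min (w (val X)) (w (val (flip_state e X))) * (Y == flip_state e X)%:R) *
    (f X - f Y) ^+ 2).
  congr (_ * _); apply: eq_bigr => Y _; have [->|XY] := eqVneq X Y.
    rewrite subrr expr0n mulr0 big1 // => e _; rewrite mulr0 //.
  by rewrite -mulr_suml -mulr_sumr -w_bond_flip // /gibbs; ring.
rewrite exchange_big mulr_sumr [RHS]mulr_sumr /=; apply: eq_bigr => e eE.
rewrite (bigD1 (flip_state e X)) //= big1 => [|Y /negbTE ->]; last first.
  by rewrite !mulr0 mul0r.
have mn := lt0r_neq0 m_gt0; have Wn := lt0r_neq0 W_gt0.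
rewrite eqxx mulr1n; field. by rewrite mn Wn.
Qed.

Definition swap_state A X Y : bond_state G :=
  Sub (swap A (val X) (val Y)) (swap_sub A (valP X) (valP Y)).

Definition swap_pair A (p : bond_state G * bond_state G) :=
  (swap_state A p.1 p.2, swap_state A p.2 p.1).

Lemma swap_pairK A : involutive (swap_pair A).
Proof.
case=> X Y; congr (_, _); apply: val_inj; apply/setP => e; rewrite /= !inE;
  by case: (e \in A); rewrite ?andbT ?andbF ?orbF.
Qed.

(** Consecutive hybrids on the path from [X] to [Y] are thus equal or one flip apart. *)
Lemma swap_stateU1 A X Y e : e \in E -> e \notin A ->
  swap_state (e |: A) X Y =
  if (e \in val X) == (e \in val Y) then swap_state A X Y
  else flip_state e (swap_state A X Y).
Proof.
move=> eE eA; apply: val_inj; case: ifP => XY; last rewrite val_flip_state //.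
  apply/setP=> u; rewrite /= !inE; case: (eqVneq u e) => [->|_] //=.
  by rewrite (eqP XY) (negbTE eA) !andbT !andbF orbF.
apply/setP=> u; rewrite in_flip /= !inE; case: (eqVneq u e) => [->|_] //=.
move: XY; rewrite (negbTE eA) !andbT !andbF !orbF /=.
by case: (e \in val X); case: (e \in val Y).
Qed.

Variables (l : seq {set G}) (K : R).
Hypothesis l_uniq : uniq l.
Hypothesis l_edges : l =i E.
Hypothesis K_ge1 : 1 <= K.

Definition prefix_set i : {set {set G}} := [set e in take i l].

Hypothesis exchange_prefix : forall i X Y,
  w (val X) * w (val Y) <=
  K * (w (val (swap_state (prefix_set i) X Y)) * w (val (swap_state (prefix_set i) Y X))).

Lemma size_l : size l = #|E|.
Proof. by rewrite -(card_uniqP l_uniq); apply: eq_card. Qed.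

(** The share of the flips of [e] in the Dirichlet form, up to the factor [(4 * m * W)^-1]. *)
Definition flow f e : R :=
  \sum_X Num.min (w (val X)) (w (val (flip_state e X))) * (f X - f (flip_state e X)) ^+ 2.

Lemma sum_hybrid_step f i : (i < size l)%N ->
  \sum_X \sum_Y w (val X) * w (val Y) *
     (f (swap_state (prefix_set i) X Y) - f (swap_state (prefix_set i.+1) X Y)) ^+ 2
  <= 2 * K * W * flow f (nth set0 l i).
Proof.
move=> il; set e := nth _ _ _.
have eE : e \in E by rewrite -l_edges mem_nth.
have eA : e \notin prefix_set i.
  rewrite inE; move: l_uniq; rewrite -{1}(cat_take_drop i l) (drop_nth set0 il).
  by rewrite cat_uniq => /and3P[_ /hasPn/(_ e) + _]; apply; rewrite mem_head.
have prefixS : prefix_set i.+1 = e |: prefix_set i.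
  by apply/setP=> u; rewrite !inE (take_nth set0 il) mem_rcons in_cons.
set A := prefix_set i in eA prefixS *.
(* At (Z, C) this is the term of [flow] at Z times the weights of both possible partners, C and its
   flip. *)
pose h (p : bond_state G * bond_state G) :=
  Num.min (w (val p.1)) (w (val (flip_state e p.1))) * (f p.1 - f (flip_state e p.1)) ^+ 2
  * (w (val p.2) + w (val (flip_state e p.2))).
have w_ge0 X : 0 <= w (val X) by exact/ltW/w_state.
have h_ge0 p : 0 <= h p.
  apply: mulr_ge0; last exact: addr_ge0.
  by apply: mulr_ge0; [rewrite le_min !w_ge0 | exact: sqr_ge0].
have step X Y : w (val X) * w (val Y) *
    (f (swap_state A X Y) - f (swap_state (prefix_set i.+1) X Y)) ^+ 2
    <= K * h (swap_pair A (X, Y)).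
  have K_ge0 : 0 <= K by apply: le_trans K_ge1.
  have := exchange_prefix i X Y; have := exchange_prefix i.+1 X Y.
  rewrite prefixS !swap_stateU1 // -/A [(_ \in val Y) == _]eq_sym.
  case: ifP => _; first by rewrite subrr expr0n mulr0 mulr_ge0.
  rewrite /h /=; set Z := swap_state A X Y; set C := swap_state A Y X => h2 h1.
  rewrite [X in _ <= K * X]mulrAC [leRHS]mulrA.
  apply: ler_wpM2r; first exact: sqr_ge0.
  (* If Z has the smaller weight, the inequality for prefix [i] pairs it with C; otherwise the one
     for [i.+1] pairs its flip with the flip of C. *)
  rewrite minEle; case: ifP => _.
    apply: le_trans h1 (ler_wpM2l K_ge0 _); apply: ler_wpM2l; first exact: (w_ge0 Z).
    by rewrite lerDl; exact: (w_ge0 (flip_state e C)).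
  apply: le_trans h2 (ler_wpM2l K_ge0 _); apply: ler_wpM2l; first exact: (w_ge0 (flip_state e Z)).
  by rewrite lerDr; exact: (w_ge0 C).
apply: le_trans (ler_sum _ (fun X _ => ler_sum _ (fun Y _ => step X Y))) _.
rewrite pair_big /= -mulr_sumr.
(* After reindexing by the involution Z and C are independent, and the sum factors into [flow f e]
   and [2 * W]. *)
have -> : \sum_p h (swap_pair A (p.1, p.2)) = \sum_p h p.
  rewrite [RHS](reindex_inj (inv_inj (swap_pairK A))).
  by apply: eq_bigr => -[].
have -> : \sum_p h p = flow f e * (\sum_C (w (val C) + w (val (flip_state e C)))).
  by rewrite -(pair_big xpredT xpredT (fun X Y => h (X, Y))) /= big_distrlr.
rewrite big_split /= [X in _ + X](_ : _ = W); last first.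
  by rewrite [RHS](reindex_inj (inv_inj (flip_stateK eE))).
by rewrite -/W le_eqVlt; apply/orP; left; apply/eqP; ring.
Qed.

Lemma sqr_sum_le n (a : 'I_n -> R) : (\sum_i a i) ^+ 2 <= n%:R * \sum_i a i ^+ 2.
Proof.
case: n a => [|n] a; first by rewrite !big_ord0 expr0n mulr0.
have n0 : n.+1%:R != 0 :> R by rewrite pnatr_eq0.
have := @jensen_sqr R _ (fun=> n.+1%:R^-1) a.
rewrite -!mulr_sumr exprMn => h.
rewrite -(ler_pM2l (_ : 0 < n.+1%:R^-1 ^+ 2)) ?exprn_gt0 ?invr_gt0 ?ltr0n //.
rewrite [leRHS]mulrA [X in _ <= X * _](_ : _ = n.+1%:R^-1); last first.
  by rewrite expr2 -mulrA mulVf // mulr1.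
apply: h => [i|]; first by rewrite invr_ge0 ler0n.
by rewrite sumr_const card_ord -[LHS]mulr_natl divff.
Qed.

Lemma sum_pairs_flow f :
  \sum_X \sum_Y w (val X) * w (val Y) * (f X - f Y) ^+ 2
  <= 2 * m * K * W * \sum_(e in E) flow f e.
Proof.
pose Zst i X Y := swap_state (prefix_set i) X Y.
have Z0 X Y : Zst 0%N X Y = X.
  by apply: val_inj; apply/setP => e; rewrite /= !inE take0 in_nil andbF.
have Zm X Y : Zst (size l) X Y = Y.
  apply: val_inj; apply/setP => e; rewrite /= !inE take_size l_edges.
  case: (boolP (e \in E)) => eE; rewrite ?andbT ?orbF ?andbF //=.
  rewrite (contraNF (subsetP (valP X) e)) //.
  by rewrite (contraNF (subsetP (valP Y) e)).
pose d i X Y := f (Zst i X Y) - f (Zst i.+1 X Y).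
have path X Y : (f X - f Y) ^+ 2 <= m * \sum_(i < size l) d i X Y ^+ 2.
  have -> : f X - f Y = \sum_(i < size l) d i X Y.
    rewrite -(big_mkord xpredT (fun i => d i X Y)) /d.
    under eq_bigr do rewrite -opprB.
    by rewrite sumrN telescope_sumr // opprB Z0 Zm.
  by rewrite /m -size_l; exact: sqr_sum_le.
have ww_ge0 X Y : 0 <= w (val X) * w (val Y).
  by rewrite mulr_ge0 // ltW // w_state.
apply: le_trans (ler_sum _ (fun X _ => ler_sum _ (fun Y _ =>
  ler_wpM2l (ww_ge0 X Y) (path X Y)))) _.
have -> : \sum_X \sum_Y w (val X) * w (val Y) * (m * \sum_(i < size l) d i X Y ^+ 2) =
    m * \sum_(i < size l) \sum_X \sum_Y w (val X) * w (val Y) * d i X Y ^+ 2.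
  rewrite [X in _ = m * X]exchange_big [RHS]mulr_sumr /=; apply: eq_bigr => X _.
  rewrite [X in _ = m * X]exchange_big [RHS]mulr_sumr /=; apply: eq_bigr => Y _.
  by rewrite mulrCA; congr (_ * _); rewrite mulr_sumr.
apply: le_trans (_ : m * \sum_(i < size l) 2 * K * W * flow f (nth set0 l i) <= _).
  rewrite ler_pM2l //; apply: ler_sum => i _; exact: sum_hybrid_step.
rewrite -mulr_sumr; have -> : \sum_(i < size l) flow f (nth set0 l i) = \sum_(e in E) flow f e.
  transitivity (\sum_(e <- l) flow f e); first by rewrite (big_nth set0) big_mkord.
  by rewrite big_uniq //; apply: eq_bigl.
by rewrite le_eqVlt; apply/orP; left; apply/eqP; ring.
Qed.

(** The constant is [2 * m * K * W] from the pairs times the [4 * m * W] of the Dirichlet form,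
    divided by the [2 * W ^+ 2] that relates the sum over pairs to the variance. *)
Lemma bond_flip_poincare f : \sum_X gibbs X * f X = 0 ->
  norm2 gibbs f <= 4 * m ^+ 2 * K * dirichlet (bond_flip w) gibbs f.
Proof.
move=> mean0.
have mn := lt0r_neq0 m_gt0; have Wn := lt0r_neq0 W_gt0.
have -> : dirichlet (bond_flip w) gibbs f = (4 * m * W)^-1 * \sum_(e in E) flow f e.
  by rewrite dirichlet_bond_flip exchange_big.
have : 2 * W ^+ 2 * norm2 gibbs f = \sum_X \sum_Y w (val X) * w (val Y) * (f X - f Y) ^+ 2.
  have wE X : w (val X) = W * gibbs X by rewrite /gibbs mulrCA divff ?mulr1.
  have inner X : \sum_Y w (val X) * w (val Y) * (f X - f Y) ^+ 2 =
      W ^+ 2 * (gibbs X * f X ^+ 2 + gibbs X * norm2 gibbs f).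
    transitivity (W ^+ 2 * gibbs X * \sum_Y (f X ^+ 2 * gibbs Y
        - 2 * f X * (gibbs Y * f Y) + gibbs Y * f Y ^+ 2)).
      rewrite mulr_sumr; apply: eq_bigr => Y _; rewrite !wE; ring.
    rewrite big_split sumrB /= -!mulr_sumr gibbs_sum1 mean0 -/(norm2 gibbs f); ring.
  under [RHS]eq_bigr do rewrite inner.
  rewrite -mulr_sumr big_split /= -mulr_suml gibbs_sum1 -/(norm2 gibbs f); ring.
move=> norm2E; have := sum_pairs_flow f; rewrite -norm2E => le_flow.
rewrite -(ler_pM2l (_ : 0 < 2 * W ^+ 2)); last by rewrite mulr_gt0 ?exprn_gt0.
apply: le_trans le_flow _.
rewrite le_eqVlt; apply/orP; left; apply/eqP; field.
by rewrite mn Wn.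
Qed.

End BondFlipChain.

(** * Mixing bounds *)

(** Equality holds at [c = 4]; from there on the cube at most doubles when its base grows by one. *)
Lemma cube_le_exp2 c : (c ^ 3 <= 4 * 2 ^ c)%N.
Proof.
case: (ltnP c 4) => [|c4]; first by case: c => [|[|[|[|]]]].
rewrite -(subnK c4); elim: (c - 4)%N => [//|d IH].
have [x4 def_x] : exists x, (d + 4 = x /\ 4 <= x)%N by exists (d + 4)%N; rewrite leq_addl.
rewrite addSn; case: def_x IH => -> x_ge IH; rewrite [(2 ^ _)%N]expnS mulnCA.
apply: leq_trans (_ : 2 * x4 ^ 3 <= _)%N; last by rewrite leq_mul2l.
rewrite !expnS !expn0; nia.
Qed.

(** [m ^ 2] stands for the Poincare constant and [n + m] for the logarithm of the inverse minimal
    probability. With [s = k.+1 * c] the product is at most 2 s^3 n^3, and [c ^ 3 <= 8 * n] trades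
    the cubed logarithm for one factor [n]. *)
Lemma volume_bound k c n m : (0 < c -> 2 ^ c <= 2 * n -> m <= k.+1 * c * n ->
  m ^ 2 * (n + m) <= 16 * k.+1 ^ 3 * n ^ 4)%N.
Proof.
move=> c_gt0 exp_c; set s := (k.+1 * c)%N => m_le.
have s_gt0 : (0 < s)%N by rewrite muln_gt0.
have c3 : (c ^ 3 <= 8 * n)%N.
  apply: leq_trans (cube_le_exp2 c) _.
  by rewrite (_ : 8 = 4 * 2)%N // -mulnA leq_mul2l.
apply: leq_trans (_ : (s * n) ^ 2 * (2 * (s * n)) <= _)%N.
  rewrite leq_mul ?leq_exp2r // mul2n -addnn leq_add //.
  by rewrite leq_pmull.
have -> : ((s * n) ^ 2 * (2 * (s * n)) = 2 * k.+1 ^ 3 * n ^ 3 * c ^ 3)%N.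
  by rewrite /s; lia.
have -> : (16 * k.+1 ^ 3 * n ^ 4 = 2 * k.+1 ^ 3 * n ^ 3 * (8 * n))%N by lia.
by rewrite leq_mul2l c3 orbT.
Qed.

Section MixingBound.
Variable R : realType.

Section Gibbs.
Variables (G : sgraph) (w : {set {set G}} -> R) (D : R) (N : nat).
Local Notation E := (edges G).
Hypothesis w_gt0 : forall S : {set {set G}}, S \subset E -> 0 < w S.
Hypothesis D_ge1 : 1 <= D.
Hypothesis w_within : forall S : {set {set G}}, S \subset E -> within (D ^+ N) 1 (w S).
Hypothesis leEN : (#|E| <= N)%N.

Lemma card_bond_state : #|bond_state G| = (2 ^ #|E|)%N.
Proof.
rewrite card_sig -card_powerset; apply: eq_card => S.
by rewrite inE powersetE.
Qed.

(** There are at most [2 ^ N] states, and two weights differ by a factor of at most [D ^+ N]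
    squared. *)
Lemma gibbs_inv_le X : (gibbs w X)^-1 <= expR (N%:R * (ln 2 + 2 * ln D)).
Proof.
have D_gt0 : 0 < D by apply: lt_le_trans D_ge1.
have -> : expR (N%:R * (ln 2 + 2 * ln D)) = 2 ^+ N * D ^+ N * D ^+ N.
  rewrite expRM_natl expRD expRM_natl !lnK ?posrE //.
  by rewrite exprMn [D ^+ 2]expr2 exprMn mulrA.
have wX := w_gt0 (valP X); have /andP[wX_ge _] := w_within (valP X).
rewrite /gibbs invf_div ler_pdivrMr // -(mulrA (2 ^+ N * D ^+ N)).
apply: le_trans (_ : _ <= 2 ^+ N * D ^+ N * 1) _; last first.
  by rewrite ler_pM2l // mulr_gt0 ?exprn_gt0.
rewrite mulr1.
apply: le_trans (_ : _ <= \sum_(S : bond_state G) D ^+ N) _.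
  apply: ler_sum => S _; have /andP[_] := w_within (valP S).
  by rewrite mulr1.
rewrite sumr_const card_bond_state -[X in X <= _]mulr_natl natrX ler_pM2r ?exprn_gt0 //.
by rewrite ler_weXn2l // ler1n.
Qed.

End Gibbs.

Lemma ln2_gt0 : 0 < ln 2 :> R.
Proof. by rewrite ln_gt0 // ltr1n. Qed.

Lemma powR_ge1 (a x : R) : 1 <= a -> 0 <= x -> 1 <= a `^ x.
Proof. by move=> a1 x0; rewrite -(powRr0 a) ler_powR. Qed.

(** 64 is the 4 of the Poincare constant times the 16 of [volume_bound]. The power of 2 remains from
    bounding [2 ^ c] by [2 * n]. The next factor absorbs the logarithm of the minimal probability
    into [ln eps^-1], and the last summand the rounding of the time. *)
Definition mixing_constant (k : nat) (beta D : R) : R :=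
  64 * k.+1%:R ^+ 3 * (2 `^ (k.+1%:R * beta)) * ((ln 2 + 2 * ln D) / ln 2 + 2)
  + (ln 2)^-1.

(** [beta] is the base 2 logarithm of the exchange loss per shared vertex, and [D] bounds the
    contribution of one vertex or edge to the weight. The constant involves only these and [k], so
    it can be fixed before the graph. *)
Lemma mixing_bound_exchange (k : nat) (beta D : R) (G : sgraph)
    (w : {set {set G}} -> R) :
    0 <= beta -> 1 <= D -> edges G != set0 -> treewidth G = k ->
    (forall S : {set {set G}}, S \subset edges G -> 0 < w S) ->
    (forall S : {set {set G}}, S \subset edges G ->
       within (D ^+ (#|G| + #|edges G|)) 1 (w S)) ->
    exchange w (2 `^ beta) ->
  mixing_bound w (mixing_constant k beta D) (4 + k.+1%:R * beta).
Proof.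
move=> beta0 D1 E0 twG w_gt0 w_within w_ex pi eps pi_stat eps0 eps2.
have [l [l_uniq lE l_bd cardE]] := treewidth_layout twG.
set n := #|G| in w_within l_bd cardE *; set m := #|edges G| in w_within cardE.
set c := trunc_log 2 n.*2 in l_bd cardE; set s := (k.+1 * c)%N in l_bd cardE.
have m_gt0 : (0 < m)%N by rewrite card_gt0.
have n_gt0 : (0 < n)%N by have := leq_trans m_gt0 cardE; rewrite muln_gt0 => /andP[].
have s_gt0 : (0 < s)%N by have := leq_trans m_gt0 cardE; rewrite muln_gt0 => /andP[].
have exp_c : (2 ^ c <= 2 * n)%N by rewrite mul2n trunc_logP // double_gt0.
pose K : R := (2 `^ beta) ^+ s.
have L1 : 1 <= 2 `^ beta :> R by rewrite powR_ge1 // ler1n.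
have K1 : 1 <= K by rewrite exprn_ege1.
have ex_prefix i (X Y : bond_state G) : w (val X) * w (val Y) <=
    K * (w (val (swap_state (prefix_set l i) X Y)) *
         w (val (swap_state (prefix_set l i) Y X))).
  set A := prefix_set l i.
  have AE : A \subset edges G.
    by apply/subsetP=> e; rewrite inE -lE => /mem_take.
  apply: le_trans (w_ex A _ _ AE (valP X) (valP Y)) _.
  rewrite ler_wpM2r ?mulr_ge0 ?(ltW (w_gt0 _ _)) ?swap_sub ?(valP X) ?(valP Y) //.
  apply: ler_weXn2l => //; apply: leq_trans (l_bd i).
  apply/subset_leq_card/subsetP=> v.
  rewrite !inE => /andP[/bigcupP[e eA ve] /bigcupP[e' /setDP[e'E e'A] ve']].
  apply/andP; split; apply/hasP; first by exists e => //; rewrite inE in eA.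
  exists e' => //; rewrite inE in e'A; move: e'E; rewrite -lE.
  by rewrite -{1}(cat_take_drop i l) mem_cat (negbTE e'A).
have poincare := bond_flip_poincare E0 w_gt0 l_uniq lE K1 ex_prefix.
rewrite -/m in poincare.
pose rho : R := 4 * m%:R ^+ 2 * K.
have rho1 : 1 <= rho.
  have m1 : 1 <= m%:R :> R by rewrite ler1n.
  have m21 : 1 <= m%:R ^+ 2 :> R by rewrite exprn_ege1.
  by rewrite /rho !mulr_ege1 // ler1n.
have P_sum1 := bond_flip_sum1 w E0.
have P_ge0 := bond_flip_ge0 w_gt0.
have P_rev := bond_flip_reversible w_gt0.
have P_lazy := bond_flip_lazy w E0.
have pi_gt0 := gibbs_gt0 w_gt0; have pi_sum1 := gibbs_sum1 E0 w_gt0.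
rewrite (stationary_uniq pi_gt0 pi_sum1 P_sum1 P_ge0 P_rev P_lazy rho1 poincare pi_stat).
set N := (n + m)%N in w_within.
have leEN : (m <= N)%N by rewrite leq_addl.
apply: (mixing_time_le pi_gt0 pi_sum1 P_sum1 P_ge0 P_rev P_lazy rho1 poincare
  (gibbs_inv_le w_gt0 D1 w_within leEN) eps0 eps2).
  by rewrite mulr_ge0 // addr_ge0 ?mulr_ge0 ?ln_ge0 ?ler1n.
have ln2 := ln2_gt0; set ell := ln eps^-1.
(* Here [eps <= 2^-1] enters: additive terms can be charged to [ell]. *)
have ell_ge : ln 2 <= ell.
  rewrite ler_ln ?posrE ?invr_gt0 // -[2]invrK lef_pV2 ?posrE // invr_gt0 //.
have lnD : 0 <= ln D by rewrite ln_ge0.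
have n1 : 1 <= n%:R :> R by rewrite ler1n.
have n0 : 0 < n%:R :> R by rewrite ltr0n.
set c1 := (ln 2 + 2 * ln D) / ln 2 + 2.
have c1_ge0 : 0 <= c1 by rewrite addr_ge0 ?divr_ge0 ?addr_ge0 ?mulr_ge0 ?(ltW ln2).
have ell_ge0 : 0 <= ell by apply: le_trans ell_ge; exact: ltW.
have kb_ge0 : 0 <= k.+1%:R * beta by rewrite mulr_ge0.
set npow := n%:R `^ (k.+1%:R * beta).
have npow1 : 1 <= npow by rewrite powR_ge1.
have -> : n%:R `^ (4 + k.+1%:R * beta) = n%:R ^+ 4 * npow.
  have n_neq0 : n%:R != 0 :> R by rewrite gt_eqF.
  by rewrite powRD ?n_neq0 ?implybT // powR_mulrn.
have B_le : N%:R * (ln 2 + 2 * ln D) + 2 * ell <= N%:R * c1 * ell.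
  have N1 : 1 <= N%:R :> R by rewrite ler1n (leq_trans m_gt0 leEN).
  have B_ge0 : 0 <= ln 2 + 2 * ln D by rewrite addr_ge0 ?mulr_ge0 ?(ltW ln2).
  have h1 : ln 2 + 2 * ln D <= (ln 2 + 2 * ln D) / ln 2 * ell.
    by rewrite mulrAC ler_pdivlMr // ler_wpM2l.
  have -> : N%:R * c1 * ell =
      N%:R * ((ln 2 + 2 * ln D) / ln 2 * ell) + N%:R * (2 * ell) by rewrite /c1; ring.
  by apply: lerD; [rewrite ler_wpM2l | rewrite ler_peMl ?mulr_ge0].
have mN_le : m%:R ^+ 2 * N%:R <= 16 * k.+1%:R ^+ 3 * n%:R ^+ 4 :> R.
  rewrite -!natrX -!natrM ler_nat.
  have c_gt0 : (0 < c)%N by move: s_gt0; rewrite muln_gt0 => /andP[].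
  exact: volume_bound c_gt0 exp_c cardE.
(* [K] is [2 ^ c] raised to [k.+1%:R * beta], and [2 ^ c] is at most [2 * n]. *)
have K_le : K <= 2 `^ (k.+1%:R * beta) * npow.
  rewrite /K -powR_mulrn ?powR_ge0 // -powRrM /s natrM.
  rewrite (_ : beta * (k.+1%:R * c%:R) = c%:R * (k.+1%:R * beta)); last by ring.
  rewrite powRrM powR_mulrn // -powRM // ?ler0n //.
  apply: ge0_ler_powR; rewrite ?nnegrE ?mulr_ge0 ?exprn_ge0 ?ler0n //.
  by rewrite -natrX -natrM ler_nat.
have rho_le : rho * (N%:R * (ln 2 + 2 * ln D) + 2 * ell) <=
    64 * k.+1%:R ^+ 3 * 2 `^ (k.+1%:R * beta) * c1 * (n%:R ^+ 4 * npow) * ell.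
  apply: le_trans (ler_wpM2l _ B_le) _; first by rewrite (le_trans _ rho1).
  have -> : rho * (N%:R * c1 * ell) = 4 * c1 * ell * (m%:R ^+ 2 * N%:R * K).
    by rewrite /rho; ring.
  have -> : 64 * k.+1%:R ^+ 3 * 2 `^ (k.+1%:R * beta) * c1 * (n%:R ^+ 4 * npow) * ell =
      4 * c1 * ell * (16 * k.+1%:R ^+ 3 * n%:R ^+ 4 * (2 `^ (k.+1%:R * beta) * npow)).
    by ring.
  apply: ler_wpM2l; first by rewrite !mulr_ge0.
  by apply: ler_pM => //; rewrite ?mulr_ge0 ?sqr_ge0 // (le_trans _ K1).
have one_le : 1 <= (ln 2)^-1 * (n%:R ^+ 4 * npow) * ell.
  rewrite mulrAC; apply: mulr_ege1; first by rewrite mulrC ler_pdivlMr // mul1r.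
  by rewrite mulr_ege1 ?exprn_ege1.
apply: le_trans (lerD rho_le one_le) _.
rewrite /mixing_constant -/c1 -/ell le_eqVlt; apply/orP; left; apply/eqP; ring.
Qed.

End MixingBound.

Section Log2.
Variable R : realType.
Implicit Types q L a b : R.

(* The larger of q and q^-1, for q > 0. *)
Definition ratio q : R := 2 `^ `|log2 q|.

Lemma ratio_ge1 q : 1 <= ratio q.
Proof. by rewrite powR_ge1 // ler1n. Qed.

Lemma log2K q : 0 < q -> 2 `^ log2 q = q.
Proof.
by move=> q0; rewrite /powR pnatr_eq0 /= /log2 divfK ?lnK // gt_eqF // ln2_gt0.
Qed.

Lemma ratioX q n : ratio q ^+ n = 2 `^ (n%:R * `|log2 q|).
Proof. by rewrite mulrC powRrM powR_mulrn ?powR_ge0. Qed.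

Lemma ratio_le q : 0 < q -> q <= ratio q.
Proof. by move=> q0; rewrite -{1}(log2K q0) ler_powR ?ler1n // ler_norm. Qed.

Lemma within_ratio q : 0 < q -> within (ratio q) 1 q.
Proof.
move=> q0; rewrite /within mulr1 ratio_le // andbT -{2}(log2K q0) -powRD.
  by rewrite powR_ge1 ?ler1n // -lerBlDr sub0r -normrN ler_norm.
by rewrite pnatr_eq0 implybT.
Qed.

Lemma within_inv L a : 0 < a -> within L 1 a -> within L 1 a^-1.
Proof.
move=> a0; rewrite /within !mulr1 => /andP[h1 h2].
by rewrite ler_pdivlMr // mul1r h2 -[a^-1]mul1r ler_pdivrMr.
Qed.

Lemma within_le L L' a b : L <= L' -> 0 <= a -> 0 <= b ->
  within L a b -> within L' a b.
Proof.
move=> LL' a0 b0 /andP[h1 h2]; apply/andP; split.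
  by apply: le_trans h1 _; rewrite ler_wpM2r.
by apply: le_trans h2 _; rewrite ler_wpM2r.
Qed.

Lemma within_powM D p q i j n m : 1 <= D -> 0 < p -> 0 < q ->
    within D 1 p -> within D 1 q -> (i <= n)%N -> (j <= m)%N ->
  within (D ^+ (n + m)) 1 (p ^+ i * q ^+ j).
Proof.
move=> D1 p0 q0 Dp Dq ni mj; have D0 : 0 <= D by apply: le_trans D1.
rewrite exprD; apply: within_mul1; rewrite ?exprn_ge0 ?(ltW p0) ?(ltW q0) //.
  exact: within_exp.
exact: within_exp.
Qed.

End Log2.

Lemma exchange_eq (R : realType) (G : sgraph) (w w' : {set {set G}} -> R) L :
    (forall S : {set {set G}}, S \subset edges G -> w S = w' S) ->
  exchange w' L -> exchange w L.
Proof.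
move=> ww' ex A X Y AE XE YE; have := ex A X Y AE XE YE.
by rewrite -!ww' ?swap_sub.
Qed.

(** Group the components by size; a component is nonempty, so its size is within the range of the
    product. *)
Lemma U_component_weight (R : realType) (G : sgraph) (x : nat -> R) (S : {set {set G}}) :
  \prod_(1 <= i < #|G|.+1) x i ^+ kappa_size i S =
  component_weight (fun K : {set G} => x #|K|) S.
Proof.
transitivity (\prod_(K in components S) \prod_(1 <= i < #|G|.+1 | i == #|K|) x i).
  rewrite (exchange_big_dep xpredT) //=; apply: eq_bigr => i _.
  by rewrite -prodr_const; apply: eq_bigl => K; rewrite inE eq_sym.
apply: eq_bigr => K KS; rewrite big_nat1_eq ifT // ltnS max_card andbT.
by rewrite card_gt0 (component_neq0 KS).
Qed.

(** * The bounds for the individual weights *)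

Section Bounds.
Variable R : realType.

Lemma multi_tutte_bound (k : nat) (q M : R) : 0 < q ->
  exists C : R, forall (G : sgraph) (v : {set G} -> R),
    edges G != set0 -> treewidth G = k ->
    (forall e, e \in edges G -> 0 < v e) ->
    \big[Num.max/0]_(e in edges G) Num.max (v e) (v e)^-1 = M ->
    mixing_bound (@multi_tutte_weight R G q v) C (4 + 4 * k.+1%:R * `|log2 q|).
Proof.
(* The maximum with 1 makes [D] at least 1 for any [M], before a graph is given. *)
move=> q0; pose D := ratio q * Num.max 1 M.
have M1 : 1 <= Num.max 1 M by rewrite le_max lexx.
have D1 : 1 <= D by rewrite mulr_ege1 ?ratio_ge1.
have D0 : 0 <= D by apply: le_trans D1.
exists (mixing_constant k (4 * `|log2 q|) D) => G v E0 twG v0 vM.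
have xiP L (K : {set G}) : ratio q <= L -> K != set0 -> 0 < q /\ within L 1 q.
  move=> qL _; split=> //; apply: within_le qL _ _ (within_ratio q0) => //.
  exact: ltW.
have kappaE S : q ^+ kappa S = component_weight (fun _ : {set G} => q) S.
  by rewrite /component_weight prodr_const.
have qkap0 S : 0 <= q ^+ @kappa G S by rewrite exprn_ge0 // ltW.
have prod0 (S : {set {set G}}) : S \subset edges G -> 0 < \prod_(e in S) v e.
  by move=> SE; apply: prodr_gt0 => e /(subsetP SE)/v0.
rewrite -mulrA mulrCA; apply: mixing_bound_exchange => //.
- by move=> S SE; rewrite /multi_tutte_weight mulr_gt0 ?exprn_gt0 ?prod0.
- move=> S SE; rewrite /multi_tutte_weight exprD.
  apply: within_mul1; rewrite ?exprn_ge0 ?(ltW (prod0 _ SE)) ?(ltW q0) //.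
    rewrite kappaE; apply: within_component_weight => // K; apply: xiP.
    by rewrite ler_peMr // (le_trans _ (ratio_ge1 q)).
  apply: within_prod => // [e eS|]; last exact: subset_leq_card.
  have eE := subsetP SE _ eS; split; first exact: v0.
  have : Num.max (v e) (v e)^-1 <= D.
    apply: (@le_trans _ _ M); first by rewrite -vM; exact: le_bigmax_cond.
    apply: (@le_trans _ _ (Num.max 1 M)); first by rewrite le_max lexx orbT.
    by rewrite ler_peMl ?ratio_ge1 // (le_trans _ M1).
  rewrite ge_max => /andP[h1 h2]; rewrite /within mulr1 h1 andbT.
  by rewrite -ler_pdivrMr ?v0 // mul1r.
- rewrite -(ratioX q 4) -[ratio q ^+ 4]mulr1.
  apply: exchangeM => //; first by rewrite exprn_ge0 // (le_trans _ (ratio_ge1 q)).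
  + by move=> S SE; exact/ltW/prod0.
  + apply: (exchange_eq (w' := component_weight (fun _ : {set G} => q))) => [S _|].
      exact: kappaE.
    by apply: exchange_component_weight => [|K]; [exact: ratio_ge1 | exact: xiP].
  + exact: exchange_prod.
Qed.

Lemma rc_bound (k : nat) (q mu : R) : 0 < q -> 0 < mu ->
  exists C : R, forall G : sgraph, edges G != set0 -> treewidth G = k ->
    mixing_bound (@rc_weight R G q mu) C (4 + 4 * k.+1%:R * `|log2 q|).
Proof.
move=> q0 mu0; have [C multiC] := multi_tutte_bound k (Num.max mu mu^-1) q0.
exists C => G E0 twG.
have -> : @rc_weight R G q mu = @multi_tutte_weight R G q (fun=> mu).
  by apply/boolp.funext => S; rewrite /multi_tutte_weight prodr_const.
apply: multiC => //; have /set0Pn[e eE] := E0; apply/le_anti/andP; split.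
  by apply: bigmax_le => //; rewrite le_max ltW.
exact: (le_bigmax_cond _ _ eE).
Qed.

(** Constants and edge counts are exchanged without loss, so only the base [(x - 1) * (y - 1)] of
    the rank factor enters the exponent. *)
Lemma tutte_weightE (G : sgraph) (x y : R) (S : {set {set G}}) :
    1 < x -> 1 < y -> S \subset edges G ->
  tutte_weight x y S = (x - 1) ^+ inc_rank (edges G) *
    ((y - 1) ^+ #|S| * ((x - 1) * (y - 1))^-1 ^+ inc_rank S).
Proof.
move=> x1 y1 SE; have x0 : x - 1 != 0 by rewrite subr_eq0 gt_eqF.
have y0 : y - 1 != 0 by rewrite subr_eq0 gt_eqF.
rewrite /tutte_weight !expfB_cond ?(negbTE x0) ?(negbTE y0) ?inc_rankS
  ?inc_rank_leq_card //.
by rewrite exprVn exprMn invfM mulrACA [RHS]mulrA.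
Qed.

Lemma tutte_bound (k : nat) (x y : R) : 1 < x -> 1 < y ->
  exists C : R, forall G : sgraph, edges G != set0 -> treewidth G = k ->
    mixing_bound (@tutte_weight R G x y) C
      (4 + 4 * k.+1%:R * `|log2 ((x - 1) * (y - 1))|).
Proof.
move=> x1 y1; have x0 : 0 < x - 1 by rewrite subr_gt0.
have y0 : 0 < y - 1 by rewrite subr_gt0.
pose z := (x - 1) * (y - 1); have z0 : 0 < z by rewrite mulr_gt0.
pose D := ratio (x - 1) * ratio (y - 1).
have D1 : 1 <= D by rewrite mulr_ege1 ?ratio_ge1.
exists (mixing_constant k (4 * `|log2 z|) D) => G E0 twG.
rewrite -mulrA mulrCA; apply: mixing_bound_exchange => //.
- by move=> S SE; rewrite /tutte_weight mulr_gt0 ?exprn_gt0.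
- move=> S SE; apply: within_powM => //.
  + apply: within_le (within_ratio x0); rewrite ?(ltW x0) //.
    by rewrite ler_peMr ?ratio_ge1 // (le_trans _ (ratio_ge1 _)).
  + apply: within_le (within_ratio y0); rewrite ?(ltW y0) //.
    by rewrite ler_peMl ?ratio_ge1 // (le_trans _ (ratio_ge1 _)).
  + by rewrite leq_subLR (leq_trans (inc_rank_leq_vertices _)) ?leq_addl.
  + by rewrite leq_subLR (leq_trans (subset_leq_card SE)) ?leq_addl.
- rewrite -(ratioX z 4) -[ratio z ^+ 4]mul1r -[X in exchange _ (1 * X)]mul1r.
  apply: (exchange_eq (w' := fun S => (x - 1) ^+ inc_rank (edges G) *
      ((y - 1) ^+ #|S| * z^-1 ^+ inc_rank S))) => [S SE|]; first exact: tutte_weightE.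
  have zV0 : 0 < z^-1 by rewrite invr_gt0.
  apply: exchangeM; rewrite ?mul1r ?exprn_ge0 ?(ltW x0) ?(le_trans _ (ratio_ge1 z)) //.
  + by move=> S _; rewrite mulr_ge0 // exprn_ge0 // ltW.
  + by apply: exchange_cst; rewrite exprn_ge0 // ltW.
  rewrite -[ratio z ^+ 4]mul1r.
  apply: exchangeM; rewrite ?exprn_ge0 ?(le_trans _ (ratio_ge1 z)) //.
  + by move=> S _; rewrite exprn_ge0 // ltW.
  + by move=> S _; rewrite exprn_ge0 // ltW.
  + exact: exchange_exp.
  + by apply: exchange_inc_rank => //; [exact: ratio_ge1 | apply/within_inv/within_ratio].
Qed.

Lemma R2_bound (k : nat) (q mu : R) : 0 < q -> 0 < mu ->
  exists C : R, forall G : sgraph, edges G != set0 -> treewidth G = k ->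
    mixing_bound (@R2_weight R G q mu) C (4 + 8 * k.+1%:R * `|log2 q|).
Proof.
move=> q0 mu0; pose D := ratio q * ratio mu.
have D1 : 1 <= D by rewrite mulr_ege1 ?ratio_ge1.
exists (mixing_constant k (8 * `|log2 q|) D) => G E0 twG.
rewrite -mulrA mulrCA; apply: mixing_bound_exchange => //.
- by move=> S SE; rewrite /R2_weight mulr_gt0 ?exprn_gt0.
- move=> S SE; apply: within_powM => //.
  + apply: within_le (within_ratio q0); rewrite ?(ltW q0) //.
    by rewrite ler_peMr ?ratio_ge1 // (le_trans _ (ratio_ge1 _)).
  + apply: within_le (within_ratio mu0); rewrite ?(ltW mu0) //.
    by rewrite ler_peMl ?ratio_ge1 // (le_trans _ (ratio_ge1 _)).
  + exact: rk2_leq_vertices.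
  + exact: subset_leq_card.
- rewrite -(ratioX q 8) -[ratio q ^+ 8]mulr1.
  apply: exchangeM; rewrite ?exprn_ge0 ?(le_trans _ (ratio_ge1 q)) //.
  + by move=> S _; rewrite exprn_ge0 // ltW.
  + by move=> S _; rewrite exprn_ge0 // ltW.
  + by apply: exchange_rk2 => //; [exact: ratio_ge1 | exact: within_ratio].
  + exact: exchange_exp.
Qed.

Lemma within_max (a M : R) : 0 < a -> Num.max a a^-1 <= M -> within M 1 a.
Proof.
move=> a0; rewrite ge_max => /andP[h1 h2]; rewrite /within mulr1 h1 andbT.
by rewrite -ler_pdivrMr // mul1r.
Qed.

Lemma max_inv_ge1 (a : R) : 0 < a -> 1 <= Num.max a a^-1.
Proof.
move=> a0; rewrite le_max; case: (leP 1 a) => //= /ltW a1.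
by rewrite invf_ge1.
Qed.

Lemma U_bound (k : nat) (x' y' : R) :
  exists C : R, forall (G : sgraph) (y : R) (x : nat -> R),
    edges G != set0 -> treewidth G = k ->
    1 < y ->
    (forall i, (1 <= i <= #|G|)%N -> 0 < x i) ->
    \big[Num.max/0]_(1 <= i < #|G|.+1) Num.max (x i) (x i)^-1 = x' ->
    Num.max (y - 1) (y - 1)^-1 = y' ->
    mixing_bound (@U_weight R G y x) C
      (4 + 4 * k.+1%:R * `|log2 (y' * x' ^+ 3)|).
Proof.
pose D := y' * x'; pose z := y' * x' ^+ 3.
exists (mixing_constant k (4 * `|log2 z|) D) => G y x E0 twG y1 x_gt0 def_x' def_y'.
have y0 : 0 < y - 1 by rewrite subr_gt0.
have y'1 : 1 <= y' by rewrite -def_y' max_inv_ge1.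
have x_le i : (1 <= i <= #|G|)%N -> Num.max (x i) (x i)^-1 <= x'.
  move=> iG; rewrite -def_x'; apply: (@bigmax_sup_seq _ _ _ _ _ i) => //.
  by rewrite mem_index_iota ltnS.
have G_gt0 : (0 < #|G|)%N.
  have /set0Pn[e eE] := E0; have [v _] := edge_neq0 eE.
  by apply/card_gt0P; exists v.
have x'1 : 1 <= x'.
  apply: le_trans (x_le 1%N _); last by rewrite G_gt0.
  by apply/max_inv_ge1/x_gt0; rewrite G_gt0.
have y'0 : 0 <= y' by apply: le_trans y'1.
have x'0 : 0 <= x' by apply: le_trans x'1.
have D1 : 1 <= D by rewrite mulr_ege1.
have D0 : 0 <= D by apply: le_trans D1.
have yP : within y' 1 (y - 1) by apply: within_max; rewrite // def_y'.
have xiP L (K : {set G}) : x' <= L -> K != set0 -> 0 < x #|K| /\ within L 1 (x #|K|).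
  rewrite -card_gt0 => xL K0; have KG : (1 <= #|K| <= #|G|)%N by rewrite K0 max_card.
  have xK := x_gt0 _ KG; split => //.
  by apply: within_max => //; apply: le_trans xL; exact: x_le.
pose cw := component_weight (fun K : {set G} => x #|K|).
have cw0 S : 0 < cw S by apply: (@component_weight_gt0 _ _ _ x') => K; exact: xiP.
have UE S : U_weight y x S = (y - 1) ^+ (#|S| - inc_rank S) * cw S.
  by rewrite /U_weight U_component_weight.
rewrite -mulrA mulrCA; apply: mixing_bound_exchange => //.
- by move=> S SE; rewrite UE mulr_gt0 ?exprn_gt0.
- move=> S SE; rewrite UE mulrC exprD.
  apply: within_mul1; rewrite ?exprn_ge0 ?(ltW (cw0 S)) ?(ltW y0) //.
    by apply: within_component_weight => // K; apply: xiP; rewrite ler_peMl.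
  apply: within_exp => //; last first.
    by rewrite leq_subLR (leq_trans (subset_leq_card SE)) ?leq_addl.
  by apply: within_le yP; rewrite ?(ltW y0) // ler_peMr.
- rewrite -(ratioX z 4); have z0 : 0 < z.
    by rewrite mulr_gt0 ?exprn_gt0 // (lt_le_trans ltr01).
  have yV0 : 0 < (y - 1)^-1 by rewrite invr_gt0.
  pose w' (S : {set {set G}}) := (y - 1) ^+ #|S| * ((y - 1)^-1 ^+ inc_rank S * cw S).
  have w'0 S : 0 <= w' S.
    by rewrite /w' !mulr_ge0 ?exprn_ge0 ?(ltW y0) ?(ltW yV0) ?(ltW (cw0 S)).
  apply: (exchange_eq (w' := w')) => [S SE|].
    rewrite UE /w' mulrA exprVn; congr (_ * _).
    by rewrite expfB_cond // (gt_eqF y0) inc_rank_leq_card.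
  (* The rank factor contributes [y' ^+ 4] and the components [x' ^+ 4]; as [x'] is at least 1,
     [y' * x'] is at most [z], hence at most [ratio z]. *)
  apply: (@exchange_le _ _ _ (1 * (y' ^+ 4 * x' ^+ 4))) => //.
    rewrite mul1r mulr_ge0 ?exprn_ge0 //= -exprMn.
    apply: lerXn2r; rewrite ?nnegrE ?powR_ge0 //.
    apply: le_trans (ratio_le z0); rewrite /z ler_wpM2l // -{1}[x']expr1.
    exact: ler_weXn2l.
  apply: exchangeM; rewrite ?mulr_ge0 ?exprn_ge0 //.
  + by move=> S _; rewrite exprn_ge0 // ltW.
  + by move=> S _; rewrite mulr_ge0 ?exprn_ge0 ?(ltW yV0) ?(ltW (cw0 S)).
  + exact: exchange_exp.
  apply: exchangeM; rewrite ?exprn_ge0 //.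
  + by move=> S _; rewrite exprn_ge0 // ltW.
  + by move=> S _; exact: ltW.
  + by apply: exchange_inc_rank => //; exact: within_inv.
  + by apply: exchange_component_weight => // K; exact: xiP.
Qed.

End Bounds.

Theorem corollary2 (R : realType) :
  (forall (k : nat) (q mu : R), 0 < q -> 0 < mu ->
     exists C : R, forall G : sgraph, edges G != set0 -> treewidth G = k ->
       mixing_bound (@rc_weight R G q mu) C
         (4 + 4 * k.+1%:R * `|log2 q|))
  /\
  (forall (k : nat) (x y : R), 1 < x -> 1 < y ->
     exists C : R, forall G : sgraph, edges G != set0 -> treewidth G = k ->
       mixing_bound (@tutte_weight R G x y) C
         (4 + 4 * k.+1%:R * `|log2 ((x - 1) * (y - 1))|))
  /\
  (forall (k : nat) (q mu : R), 0 < q -> 0 < mu ->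
     exists C : R, forall G : sgraph, edges G != set0 -> treewidth G = k ->
       mixing_bound (@R2_weight R G q mu) C
         (4 + 8 * k.+1%:R * `|log2 q|))
  /\
  (forall (k : nat) (q M : R), 0 < q ->
     exists C : R, forall (G : sgraph) (v : {set G} -> R),
       edges G != set0 -> treewidth G = k ->
       (forall e, e \in edges G -> 0 < v e) ->
       \big[Num.max/0]_(e in edges G) Num.max (v e) (v e)^-1 = M ->
       mixing_bound (@multi_tutte_weight R G q v) C
         (4 + 4 * k.+1%:R * `|log2 q|))
  /\
  (forall (k : nat) (x' y' : R),
     exists C : R, forall (G : sgraph) (y : R) (x : nat -> R),
       edges G != set0 -> treewidth G = k ->
       1 < y ->
       (forall i, (1 <= i <= #|G|)%N -> 0 < x i) ->
       \big[Num.max/0]_(1 <= i < #|G|.+1) Num.max (x i) (x i)^-1 = x' ->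
       Num.max (y - 1) (y - 1)^-1 = y' ->
       mixing_bound (@U_weight R G y x) C
         (4 + 4 * k.+1%:R * `|log2 (y' * x' ^+ 3)|)).
Proof.
split; first exact: rc_bound.
split; first exact: tutte_bound.
split; first exact: R2_bound.
split; first exact: multi_tutte_bound.
exact: U_bound.
Qed.
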